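(* For $t\in\mathbb{C}$ let $A_t(x,y)=x^6+tx^4y^2+tx^2y^4+y^6$. A binary sextic form $p\in\mathbb{C}[x,y]$ has $N(p)=2$ if and only if $p$ is similar to $A_t$ for some $t\in\mathbb{C}\setminus\{3,-1,0,15,-5\}$. Moreover $N(A_3)=0$, $N(A_{-1})=1$, $N(A_0)=N(A_{15})=4$ and $N(A_{-5})=6$.
   Context: Two forms $p,p'\in\mathbb{C}[x,y]$ are similar if $p'=p\circ M$ for some invertible linear change $M(x,y)=(\alpha x+\beta y,\gamma x+\delta y)$, $\alpha\delta-\beta\gamma\ne0$. For a binary sextic $p$, $N(p)$ is the number of representations $p=f_1^3+f_2^3$ with $f_1,f_2\in\mathbb{C}[x,y]$ non-proportional quadratic forms, where two representations are counted as the same if the unordered pairs $\{f_1^3,f_2^3\}$ coincide. *)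

(* Defs.v *)
From HB Require Import structures.
From mathcomp Require Import all_boot all_order all_algebra.
From mathcomp Require Import complex.
From mathcomp Require Import classical_sets functions cardinality reals.
From mathcomp Require Import mpoly.

Set Implicit Arguments.
Unset Strict Implicit.
Unset Printing Implicit Defensive.

Import Order.TTheory GRing.Theory Num.Theory.

Local Open Scope ring_scope.
Local Open Scope classical_set_scope.
Local Open Scope card_scope.

Section BinaryForms.
Variable C : fieldType.
Implicit Types (p q f g : {mpoly C[2]}).

Definition formX : {mpoly C[2]} := 'X_(ord0 : 'I_2).
Definition formY : {mpoly C[2]} := 'X_(ord_max : 'I_2).

Definition similar_forms p q : Prop :=
  exists a b c d : C,
    a * d - b * c != 0 /\
    q = p \mPo [tuple a *: formX + b *: formY; c *: formX + d *: formY].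

(* The zero form is proportional to every form. *)
Definition proportional f g : Prop :=
  (exists c : C, f = c *: g) \/ (exists c : C, g = c *: f).

(* The representations of [p], each recorded as the unordered pair of cubes,
   which is here a set of forms. *)
Definition representations p : set (set {mpoly C[2]}) :=
  [set S | exists f1 f2 : {mpoly C[2]},
     [/\ f1 \is 2.-homog, f2 \is 2.-homog, ~ proportional f1 f2,
         p = f1 ^+ 3 + f2 ^+ 3 & S = [set f1 ^+ 3; f2 ^+ 3]]].

(* N(p) = n; a relation, so that an infinite set of representations is not
   given a default cardinal. *)
Definition N_is p (n : nat) : Prop := representations p #= `I_n.

Definition sextic_A (t : C) : {mpoly C[2]} :=
  formX ^+ 6 + t *: (formX ^+ 4 * formY ^+ 2)
  + t *: (formX ^+ 2 * formY ^+ 4) + formY ^+ 6.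

End BinaryForms.

(* Main.v *)
(* If f1^3 + f2^3 = p, the pencil of f1, f2 is either spanned by the squares of two independent
   linear forms or has a common linear factor (look at the Jacobian of f1, f2).  In the second
   case the representation is the only one.  In the first case one may take f1, f2 even in y;
   then y -> -y permutes the representations of p, and if there are exactly two it must exchange
   the two cubes of the other one, so p = f(x,y)^3 + f(x,-y)^3, which is similar to some A_t.
   Conversely, for t <> 3 the substitution (x + y, i(x - y)) makes A_t a multiple of
   xy(x^4 + s x^2 y^2 + y^4) with s = 2(5+t)/(3-t), whose extreme coefficients vanish; comparing
   coefficients then solves the equation completely, with extra solutions only for s = 0 and
   s = +-10/3, and one solution missing for s = +-2. *)
Require Import Defs.
From mathcomp Require Import all_boot all_order all_algebra.
From mathcomp Require Import complex reals mpoly.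
From mathcomp Require Import classical_sets functions cardinality boolp.
From mathcomp Require Import ring.

Set Implicit Arguments.
Unset Strict Implicit.
Unset Printing Implicit Defensive.

Import Order.TTheory GRing.Theory Num.Theory.

Local Open Scope ring_scope.

(** * Binary forms in coordinates and linear substitutions *)

Section Forms.
Variable C : numClosedFieldType.
Implicit Types (a b c d e f t : C) (p q : {mpoly C[2]}).

Notation X := (formX C).
Notation Y := (formY C).

(** A representation is an unordered pair of cubes, so its forms are known only up to cube roots of
    unity and up to exchange. Counting therefore lists one cube per pair, and the obstacle is to
    exclude that two listed cubes coincide or add up to p; a few coefficients decide this. The
    substitution (x + y, i(x - y)) comes from A_t = (x^2 + y^2)(x^4 + (t-1) x^2 y^2 + y^4): it sends
    the factors x + iy and x - iy, common to all A_t, to multiples of y and x. The exceptional t are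
    read off from 2(5 + t) = s(3 - t): s = 2 at t = -1, s = 0 at t = -5, s = 10/3 at t = 0, s =
    -10/3 at t = 15, while s = -2 would force 16 = 0; t = 3 leaves a multiple of x^3 y^3. The
    generic count 2 is one pair for each sign e, lost when s = 2e. A second family of solutions adds
    four pairs at s = 0 and two at s = +-10/3. *)

Definition mon i j : 'X_{1..2} := [multinom if k == ord0 then i else j | k < 2].

Lemma monP (m m' : 'X_{1..2}) : m ord0 = m' ord0 -> m ord_max = m' ord_max -> m = m'.
Proof.
move=> h0 h1; apply/mnmP => k; have [->//|k0] := eqVneq k ord0.
by rewrite (_ : k = ord_max) //; apply/val_inj; move: k k0 => [[|[|]]].
Qed.

Lemma monK (m : 'X_{1..2}) : mon (m ord0) (m ord_max) = m.
Proof. by apply: monP; rewrite mnmE. Qed.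

Lemma monE i j : X ^+ i * Y ^+ j = 'X_[mon i j].
Proof.
rewrite mpolyXE_id big_ord_recl big_ord1 !mnmE /= /formX /formY.
by congr (_ * 'X_ _ ^+ _); exact: val_inj.
Qed.

Lemma eq_mon (i j k l : nat) : (mon i j == mon k l) = (i == k) && (j == l).
Proof.
apply/eqP/andP => [e|[/eqP-> /eqP->]//].
have := congr1 (fun m : 'X_{1..2} => m ord0) e.
have := congr1 (fun m : 'X_{1..2} => m ord_max) e.
by rewrite /= !mnmE /= => -> ->.
Qed.

Definition qform a b c : {mpoly C[2]} :=
  a *: X ^+ 2 + b *: (X * Y) + c *: Y ^+ 2.

Definition sform (s : seq C) : {mpoly C[2]} :=
  \sum_(i < 7) s`_i *: (X ^+ (6 - i) * Y ^+ i).

Lemma sform_coef s i : (i < 7)%N -> (sform s)@_(mon (6 - i) i) = s`_i.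
Proof.
move=> hi; rewrite /sform raddf_sum (bigD1 (Ordinal hi)) //= big1 => [|j nj].
  by rewrite mcoeffZ monE mcoeffX eqxx mulr1 addr0.
rewrite mcoeffZ monE mcoeffX eq_mon.
have /negPf-> : nat_of_ord j != i by apply: contra nj => /eqP e; apply/eqP/val_inj.
by rewrite andbF mulr0.
Qed.

Lemma sform_inj s s' : size s = 7%N -> size s' = 7%N -> sform s = sform s' -> s = s'.
Proof.
move=> h h' e; apply: (@eq_from_nth _ 0); rewrite h ?h' // => i hi.
by rewrite -(sform_coef s hi) e sform_coef.
Qed.

Lemma sformD s s' : size s = 7%N -> size s' = 7%N ->
  sform s + sform s' = sform [seq x.1 + x.2 | x <- zip s s'].
Proof.
move=> h h'; rewrite -big_split /=; apply: eq_bigr => i _.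
rewrite -scalerDl; congr (_ *: _).
by rewrite (nth_map 0) ?nth_zip ?size_zip ?h ?h'.
Qed.

Lemma sformE c0 c1 c2 c3 c4 c5 c6 :
  sform [:: c0; c1; c2; c3; c4; c5; c6] =
  c0%:MP * X ^+ 6 + c1%:MP * (X ^+ 5 * Y) + c2%:MP * (X ^+ 4 * Y ^+ 2)
  + c3%:MP * (X ^+ 3 * Y ^+ 3) + c4%:MP * (X ^+ 2 * Y ^+ 4)
  + c5%:MP * (X * Y ^+ 5) + c6%:MP * Y ^+ 6.
Proof.
by rewrite /sform !big_ord_recl big_ord0 addr0 !addrA -!mul_mpolyC -[X ^+ 6 in RHS]mulr1 -[Y ^+ 6 in RHS]mul1r.
Qed.

Lemma qformE a b c :
  qform a b c = a%:MP * X ^+ 2 + b%:MP * (X * Y) + c%:MP * Y ^+ 2.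
Proof. by rewrite !mul_mpolyC. Qed.

Lemma qform_cube a b c :
  qform a b c ^+ 3 = sform [:: a ^+ 3; 3 * a ^+ 2 * b; 3 * a ^+ 2 * c + 3 * a * b ^+ 2;
    b ^+ 3 + 6 * a * b * c; 3 * a * c ^+ 2 + 3 * b ^+ 2 * c; 3 * b * c ^+ 2; c ^+ 3].
Proof.
by rewrite sformE qformE; ring.
Qed.

Lemma qform_coef a b c : [/\ (qform a b c)@_(mon 2 0) = a,
  (qform a b c)@_(mon 1 1) = b & (qform a b c)@_(mon 0 2) = c].
Proof.
have -> : qform a b c = a *: (X ^+ 2 * Y ^+ 0) + b *: (X ^+ 1 * Y ^+ 1)
    + c *: (X ^+ 0 * Y ^+ 2) by rewrite /qform; congr (_ *: _ + _ *: _ + _ *: _); rewrite ?expr0 ?mulr1 ?mul1r.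
rewrite !monE; split; rewrite !mcoeffD !mcoeffZ !mcoeffX !eq_mon /=;
by rewrite ?(mulr0, mulr1, addr0, add0r).
Qed.

Lemma qform_homog a b c : qform a b c \is 2.-homog.
Proof.
have h i j : (i + j = 2)%N -> X ^+ i * Y ^+ j \is 2.-homog.
  move=> e; rewrite monE dhomogX /=.
  by rewrite mdegE big_ord_recl big_ord1 !mnmE /= e.
rewrite /qform !rpredD ?rpredZ //.
- by have := h 2%N 0%N erefl; rewrite expr0 mulr1.
- by have := h 1%N 1%N erefl.
- by have := h 0%N 2%N erefl; rewrite expr0 mul1r.
Qed.

Lemma qformP p : p \is 2.-homog -> exists a b c, p = qform a b c.
Proof.
move=> hp; exists p@_(mon 2 0), p@_(mon 1 1), p@_(mon 0 2).
apply/mpolyP => m; have [dm|dm] := eqVneq (mdeg m) 2%N; last first.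
  by rewrite (dhomog_nemf_coeff hp dm) (dhomog_nemf_coeff (qform_homog _ _ _) dm).
have [q0 q1 q2] := qform_coef p@_(mon 2 0) p@_(mon 1 1) p@_(mon 0 2).
move: dm; rewrite mdegE big_ord_recl big_ord1 /=.
have -> : lift ord0 ord0 = ord_max :> 'I_2 by exact: val_inj.
rewrite -(monK m) !mnmE /=.
by case: (m ord0) (m ord_max) => [|[|[|?]]] [|[|[|?]]] dm; try discriminate dm; rewrite ?q0 ?q1 ?q2.
Qed.

Definition lin a b c d p := p \mPo [tuple a *: X + b *: Y; c *: X + d *: Y].

(** A product of equations, so that a single [rewrite] may use any of them. *)
Lemma lin_morph a b c d :
  (forall p q, lin a b c d (p + q) = lin a b c d p + lin a b c d q) *
  (forall p q, lin a b c d (p * q) = lin a b c d p * lin a b c d q) *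
  (forall p n, lin a b c d (p ^+ n) = lin a b c d p ^+ n) *
  (forall x p, lin a b c d (x *: p) = x *: lin a b c d p) *
  (forall x, lin a b c d (x%:MP) = x%:MP).
Proof.
do !split=> *; rewrite /lin ?(rmorphD, rmorphM, rmorphXn, linearZ, comp_mpolyC) //.
Qed.

Lemma linX a b c d : lin a b c d X = a%:MP * X + b%:MP * Y.
Proof. by rewrite /lin comp_mpolyXU /= !mul_mpolyC. Qed.

Lemma linY a b c d : lin a b c d Y = c%:MP * X + d%:MP * Y.
Proof. by rewrite /lin comp_mpolyXU /= !mul_mpolyC. Qed.

Definition linE := (lin_morph, linX, linY).

Lemma lin_qform a b c d e f t : lin a b c d (qform e f t) =
  qform (e * a ^+ 2 + f * a * c + t * c ^+ 2)
    (2 * e * a * b + f * (a * d + b * c) + 2 * t * c * d)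
    (e * b ^+ 2 + f * b * d + t * d ^+ 2).
Proof. by rewrite !qformE !linE; ring. Qed.

Lemma lin_lin a b c d a' b' c' d' p :
  lin a' b' c' d' (lin a b c d p) =
  lin (a * a' + b * c') (a * b' + b * d') (c * a' + d * c') (c * b' + d * d') p.
Proof.
elim/mpolyind: p => [|e m p _ _ IH]; first by rewrite /lin !comp_mpoly0.
have hm : lin a' b' c' d' (lin a b c d 'X_[m]) =
  lin (a * a' + b * c') (a * b' + b * d') (c * a' + d * c') (c * b' + d * d') 'X_[m].
  by rewrite -(monK m) -monE !linE; congr (_ ^+ _ * _ ^+ _); ring.
by rewrite !lin_morph IH hm.
Qed.

Lemma lin_id p : lin 1 0 0 1 p = p.
Proof.
elim/mpolyind: p => [|e m p _ _ IH]; first by rewrite /lin !comp_mpoly0.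
have hm : lin 1 0 0 1 'X_[m] = 'X_[m].
  by rewrite -(monK m) -monE !linE; congr (_ ^+ _ * _ ^+ _); ring.
by rewrite !lin_morph IH hm.
Qed.

End Forms.

(** * Representations and similarity *)

Section Reps.
Local Open Scope classical_set_scope.
Local Open Scope card_scope.
Variable C : numClosedFieldType.
Implicit Types (a b c d e f t : C) (p q : {mpoly C[2]}).

Lemma qform_inj a b c d e f : qform a b c = qform d e f -> [/\ a = d, b = e & c = f].
Proof.
move=> h; have := qform_coef a b c; rewrite h.
by have [-> -> ->] := qform_coef d e f; case.
Qed.

Lemma qformZ t a b c : t *: qform a b c = qform (t * a) (t * b) (t * c).
Proof. by rewrite /qform !scalerDr !scalerA. Qed.

Lemma proportional_sym p q : proportional p q -> proportional q p.
Proof. by case=> h; [right|left]. Qed.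

(** The conditions are the vanishing of the 2x2 minors. For the converse, a nonzero coefficient of
    the first form gives the factor that carries it to the second; if there is none, the first form
    is zero. *)
Lemma qform_proportional a b c d e f : proportional (qform a b c) (qform d e f) <->
  [/\ a * e = b * d, a * f = c * d & b * f = c * e].
Proof.
split=> [[[t]|[t]]|[h1 h2 h3]].
- by rewrite qformZ => /qform_inj[-> -> ->]; split; ring.
- by rewrite qformZ => /qform_inj[-> -> ->]; split; ring.
have [a0|a0] := eqVneq a 0; last first.
  right; exists (d / a); rewrite qformZ; congr qform; first by field.
    by rewrite mulrAC (mulrC d) -h1; field.
  by rewrite mulrAC (mulrC d) -h2; field.
have [b0|b0] := eqVneq b 0; last first.
  right; exists (e / b); rewrite qformZ; congr qform; last 1 first.
  - by rewrite mulrAC (mulrC e) -h3; field.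
  - by rewrite mulrAC (mulrC e) h1; field.
  - by field.
have [c0|c0] := eqVneq c 0; last first.
  right; exists (f / c); rewrite qformZ; congr qform; last by field.
  - by rewrite mulrAC (mulrC f) h2; field.
  - by rewrite mulrAC (mulrC f) h3; field.
by left; exists 0; rewrite qformZ a0 b0 c0 !mul0r.
Qed.

(** A representation with an order and a choice of quadratic forms; [representations] keeps only the
    pair of cubes. *)
Definition rep p (f g : {mpoly C[2]}) : Prop :=
  [/\ f \is 2.-homog, g \is 2.-homog, ~ proportional f g & p = f ^+ 3 + g ^+ 3].

Lemma representationsE p S :
  representations p S <-> exists f g : {mpoly C[2]}, rep p f g /\ S = [set f ^+ 3; g ^+ 3].
Proof.
split=> [[f [g [h1 h2 h3 h4 h5]]]|[f [g [[h1 h2 h3 h4] h5]]]]; exists f, g => //.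
Qed.

Lemma rep_sym p (f g : {mpoly C[2]}) : rep p f g -> rep p g f.
Proof. by case=> ? ? h ?; split=> //; [move/proportional_sym|rewrite addrC]. Qed.

Lemma lin_lin_id a b c d a' b' c' d' p : a * a' + b * c' = 1 -> a * b' + b * d' = 0 ->
  c * a' + d * c' = 0 -> c * b' + d * d' = 1 -> lin a' b' c' d' (lin a b c d p) = p.
Proof. by rewrite lin_lin => -> -> -> ->; rewrite lin_id. Qed.

Lemma linK a b c d : a * d - b * c != 0 -> exists a' b' c' d' : C,
  [/\ a' * d' - b' * c' != 0, cancel (lin a b c d) (lin a' b' c' d')
    & cancel (lin a' b' c' d') (lin a b c d)].
Proof.
(* The determinant becomes a single atom for [field]; the inverse is the adjugate matrix over D. *)
have [D e1] : exists D, D = a * d - b * c by exists (a * d - b * c).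
rewrite -e1 => D0.
exists (d / D), (- b / D), (- c / D), (a / D); split.
- have -> : d / D * (a / D) - - b / D * (- c / D) = (a * d - b * c) / D ^+ 2 by field.
  by rewrite -e1 mulf_neq0 ?invr_eq0 ?expf_neq0.
- move=> p; apply: lin_lin_id; rewrite e1; field; by rewrite -e1.
- move=> p; apply: lin_lin_id; rewrite e1; field; by rewrite -e1.
Qed.

Lemma lin_inj a b c d : a * d - b * c != 0 -> injective (lin a b c d).
Proof. by move=> /linK[a' [b' [c' [d' [_ /can_inj]]]]]. Qed.

Lemma lin_proportional a b c d p q :
  proportional p q -> proportional (lin a b c d p) (lin a b c d q).
Proof.
by case=> -[t ->]; [left|right]; exists t; rewrite linE.
Qed.

Lemma lin_homog2 a b c d p : p \is 2.-homog -> lin a b c d p \is 2.-homog.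
Proof.
by move=> /qformP[e [f [t ->]]]; rewrite lin_qform qform_homog.
Qed.

Lemma lin_rep a b c d p (f g : {mpoly C[2]}) : a * d - b * c != 0 ->
  rep p f g -> rep (lin a b c d p) (lin a b c d f) (lin a b c d g).
Proof.
move=> D0 [h1 h2 h3 ->]; split; rewrite ?lin_homog2 ?linE //.
have [a' [b' [c' [d' [_ k _]]]]] := linK D0.
by move=> /(lin_proportional a' b' c' d'); rewrite !k.
Qed.

Lemma lin_representations a b c d p : a * d - b * c != 0 ->
  representations (lin a b c d p) = [set lin a b c d @` S | S in representations p].
Proof.
move=> D0; have [a' [b' [c' [d' [D0' k k']]]]] := linK D0.
apply/seteqP; split=> S /=; last first.
  move=> [T /representationsE[f [g [r ->]]] <-].
  apply/representationsE; exists (lin a b c d f), (lin a b c d g).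
  by rewrite image_setU !image_set1 !linE; split=> //; apply: lin_rep.
move=> /representationsE[f [g [r ->]]].
exists [set (lin a' b' c' d' f) ^+ 3; (lin a' b' c' d' g) ^+ 3].
  apply/representationsE; exists (lin a' b' c' d' f), (lin a' b' c' d' g).
  by split=> //; rewrite -(k p); apply: lin_rep.
by rewrite image_setU !image_set1 !lin_morph !k'.
Qed.

Lemma N_is_lin a b c d p n : a * d - b * c != 0 -> N_is p n -> N_is (lin a b c d p) n.
Proof.
rewrite /N_is => D0 h; rewrite lin_representations //.
apply: card_eq_trans h; apply: inj_card_eq => S T _ _ e.
have i := lin_inj D0.
by rewrite funeqE => q; rewrite -(image_inj (A := S) i) e (image_inj i).
Qed.

Lemma similar_sym p q : similar_forms p q -> similar_forms q p.
Proof.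
move=> [a [b [c [d [D0 ->]]]]]; have [a' [b' [c' [d' [D0' k k']]]]] := linK D0.
by exists a', b', c', d'; split=> //; rewrite -[LHS](k p).
Qed.

Lemma similar_trans p q r : similar_forms p q -> similar_forms q r -> similar_forms p r.
Proof.
move=> [a [b [c [d [D0 ->]]]]] [a' [b' [c' [d' [D0' ->]]]]].
exists (a * a' + b * c'), (a * b' + b * d'), (c * a' + d * c'), (c * b' + d * d').
split; last exact: lin_lin.
apply: contra_neq (mulf_neq0 D0 D0') => <-; ring.
Qed.

Lemma N_is_similar p q n : similar_forms p q -> N_is p n <-> N_is q n.
Proof.
move=> h; have [a [b [c [d [D0 eq]]]]] := h.
have [a' [b' [c' [d' [D0' ep]]]]] := similar_sym h.
by split; [rewrite eq|rewrite ep]; apply: N_is_lin.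
Qed.

Lemma N_is_inj p m n : N_is p m -> N_is p n -> m = n.
Proof.
by move=> h1 h2; apply/(@card_eq_II m n); apply: card_eq_trans h2; apply: card_esym.
Qed.

Lemma eq_set2 (T : Type) (x y u v : T) : [set x; y] = [set u; v] ->
  (x = u /\ y = v) \/ (x = v /\ y = u).
Proof.
move=> e.
have h z : z = x \/ z = y <-> z = u \/ z = v.
  by have := congr1 (fun A : set T => A z) e => /= ->.
have hx := (h x).1 (or_introl erefl); have hy := (h y).1 (or_intror erefl).
have hu := (h u).2 (or_introl erefl); have hv := (h v).2 (or_intror erefl).
by case: hx => hx; case: hy => hy; case: hu => hu; case: hv => hv; subst; tauto.
Qed.

(** Either cube of a pair determines the other as its difference from p. If no two entries of s,
    equal or not, sum to p, then no pair is listed through both of its cubes, and pairs correspond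
    to indices. *)
Lemma N_is_seq p (s : seq {mpoly C[2]}) :
  (forall q, q \in s -> exists f g : {mpoly C[2]}, rep p f g /\ q = f ^+ 3) ->
  (forall f g : {mpoly C[2]}, rep p f g -> f ^+ 3 \in s \/ g ^+ 3 \in s) ->
  uniq s -> (forall q r, q \in s -> r \in s -> q + r != p) -> N_is p (size s).
Proof.
move=> hs hc us hn; rewrite /N_is.
have -> : representations p = (fun i => [set s`_i; p - s`_i]) @` `I_(size s).
  apply/seteqP; split=> S /=.
    move=> /representationsE[f [g [r ->]]].
    have [_ _ _ ep] := r.
    case: (hc _ _ r) => h.
      exists (index (f ^+ 3) s) => /=; first by rewrite index_mem.
      by rewrite nth_index // ep [_ + g ^+ 3]addrC addrK.
    exists (index (g ^+ 3) s) => /=; first by rewrite index_mem.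
    by rewrite nth_index // ep addrK setUC.
  move=> [i hi <-]; have [f [g [r ->]]] := hs _ (mem_nth 0 hi).
  apply/representationsE; exists f, g; split=> //.
  by have [_ _ _ ->] := r; rewrite [_ + g ^+ 3]addrC addrK.
apply: inj_card_eq => i j; rewrite !inE /= => hi hj e0; have [[e _]|[e _]] := eq_set2 e0.
  by apply/eqP; rewrite -(nth_uniq 0 hi hj us) e.
by have := hn _ _ (mem_nth 0 hi) (mem_nth 0 hj); rewrite e subrK eqxx.
Qed.

Lemma N_is2 p : N_is p 2 -> exists S1 S2, S1 <> S2 /\ representations p = [set S1; S2].
Proof.
rewrite /N_is => /card_esym/card_set_bijP[f [ff fi fs]].
exists (f 0%N), (f 1%N); split.
  by move=> /fi; rewrite !inE /= => /(_ erefl erefl).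
apply/seteqP; split=> S /=.
  by move=> /fs[[|[|i]] // _ <-]; [left|right].
by case=> ->; apply: ff.
Qed.

End Reps.

(** * Solving for the sextics xy(x^4 + s x^2 y^2 + y^4) *)

(** Certificates for polynomial consequences: the cofactors are supplied by hand, and what remains
    is an identity for [ring]. *)
Lemma lincomb1 (R : pzRingType) (k l r x y : R) :
  l = r -> x - y = k * (l - r) -> x = y.
Proof. by move=> -> h; apply/eqP; rewrite -subr_eq0 h subrr mulr0. Qed.

Lemma lincomb2 (R : pzRingType) (k k' l r l' r' x y : R) :
  l = r -> l' = r' -> x - y = k * (l - r) + k' * (l' - r') -> x = y.
Proof. by move=> -> -> h; apply/eqP; rewrite -subr_eq0 h !subrr !mulr0 addr0. Qed.

Lemma lincomb3 (R : pzRingType) (k k' k2 l r l' r' l2 r2 x y : R) :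
  l = r -> l' = r' -> l2 = r2 ->
  x - y = k * (l - r) + k' * (l' - r') + k2 * (l2 - r2) -> x = y.
Proof. by move=> -> -> -> h; apply/eqP; rewrite -subr_eq0 h !subrr !mulr0 !addr0. Qed.

Arguments lincomb3 {R} k k' k2 {l r l' r' l2 r2 x y}.
Arguments lincomb1 {R} k {l r x y}.
Arguments lincomb2 {R} k k' {l r l' r' x y}.

Section Solve.
Variable C : numClosedFieldType.
Implicit Types (a b c d e f s t z w : C).

Lemma rep_sformP s0 s1 s2 s3 s4 s5 s6 a b c d e f :
  rep (sform [:: s0; s1; s2; s3; s4; s5; s6]) (qform a b c) (qform d e f) <->
  ~ [/\ a * e = b * d, a * f = c * d & b * f = c * e] /\
  [/\ a ^+ 3 + d ^+ 3 = s0,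
    3 * a ^+ 2 * b + 3 * d ^+ 2 * e = s1,
    3 * a ^+ 2 * c + 3 * a * b ^+ 2 + (3 * d ^+ 2 * f + 3 * d * e ^+ 2) = s2 &
  [/\ b ^+ 3 + 6 * a * b * c + (e ^+ 3 + 6 * d * e * f) = s3,
    3 * a * c ^+ 2 + 3 * b ^+ 2 * c + (3 * d * f ^+ 2 + 3 * e ^+ 2 * f) = s4,
    3 * b * c ^+ 2 + 3 * e * f ^+ 2 = s5 &
    c ^+ 3 + f ^+ 3 = s6]].
Proof.
rewrite -qform_proportional; split.
  move=> [_ _ h]; rewrite !qform_cube sformD // => /sform_inj - /(_ erefl erefl)/= e0.
  by split=> //; case: e0 => -> -> -> -> -> -> ->.
move=> [h [h0 h1 h2 [h3 h4 h5 h6]]]; split; rewrite ?qform_homog //.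
by rewrite !qform_cube sformD //= h0 h1 h2 h3 h4 h5 h6.
Qed.

Definition Ps s : {mpoly C[2]} := sform [:: 0; 1; 0; s; 0; 1; 0].

Variable w : C.
Hypothesis w_root : w ^+ 2 + w + 1 = 0.

Lemma w3 : w ^+ 3 = 1.
Proof. by apply: (lincomb1 (w - 1) w_root); ring. Qed.

Lemma cube_root1 z : z ^+ 3 = 1 -> [\/ z = 1, z = w | z = w ^+ 2].
Proof.
move=> z3; have : (z - 1) * (z - w) * (z - w ^+ 2) = 0.
  by apply: (lincomb2 1 ((z - 1) * (w - 1 - z)) z3 w_root); ring.
move/eqP; rewrite !mulf_eq0 !subr_eq0 -orbA => /or3P[] /eqP ->;
by [constructor 1|constructor 2|constructor 3].
Qed.

Lemma nz3 : (3 : C) != 0. Proof. by rewrite pnatr_eq0. Qed.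

Lemma w_neq1 : w != 1.
Proof.
apply/eqP => w1; have /eqP := nz3; apply.
by rewrite -w_root w1; ring.
Qed.

Lemma cube_eq a b : a ^+ 3 = b ^+ 3 -> exists z, z ^+ 3 = 1 /\ a = z * b.
Proof.
have [->|b0] := eqVneq b 0.
  rewrite expr0n /= => /eqP; rewrite expf_eq0 /= => /eqP ->.
  by exists 1; rewrite expr1n mul1r.
by exists (a / b); rewrite expr_div_n H divff ?expf_neq0 // divfK.
Qed.

Definition is_sign e := e = 1 \/ e = -1.

(* The x^6 and y^6 coefficients of Ps s vanish, so after multiplying g by a cube root of 1 the
   x^2 coefficients of f and g are opposite, and their y^2 coefficients are opposite up to a cube
   root of 1: the root 1 leads to shapeI, w to shapeII, and w^2 is w with f and g exchanged. *)
Definition shapeI e s (f g : {mpoly C[2]}) := exists a b, [/\ f = qform a b (e * a),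
  g = qform (- a) b (- (e * a)), 6 * a ^+ 2 * b = 1 & 2 * b ^+ 3 = s - 2 * e].

Definition shapeII e s (f g : {mpoly C[2]}) := exists a b c, [/\ f = qform a b c,
  g = qform (- a) (e * w ^+ 2 * b) (- (w * c)) &
  [/\ a * c = - b ^+ 2, 3 * a ^+ 2 * b * (1 + e * w ^+ 2) = 1,
     9 * b ^+ 6 * (2 - e) = 1 & s = - 5 * (1 + e) * b ^+ 3]].

Lemma sqr_sign a b : a ^+ 2 = b ^+ 2 -> exists e, is_sign e /\ a = e * b.
Proof.
move/eqP; rewrite eqf_sqr => /orP[] /eqP ->.
  by exists 1; rewrite mul1r; split; [left|].
by exists (-1); rewrite mulN1r; split; [right|].
Qed.

(** The x^4 y^2 coefficient gives e^2 = b^2, and e = -b would make the x^5 y coefficient vanish.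
    With e = b, comparing the x^5 y and x y^5 coefficients, both 1, gives c^2 = a^2; the x^3 y^3
    coefficient then yields b^3. *)
Lemma rep_shapeI s a b c e :
  rep (Ps s) (qform a b c) (qform (- a) e (- c)) ->
  exists2 t, is_sign t & shapeI t s (qform a b c) (qform (- a) e (- c)).
Proof.
move=> /rep_sformP[_ [_ E1 E2 [E3 E4 E5 _]]].
have a0 : a != 0.
  apply/eqP => a0; have /eqP := oner_neq0 C; apply.
  by rewrite -[LHS]E1 a0; ring.
have H2 : e ^+ 2 = b ^+ 2.
  apply: (mulfI nz3); apply: (mulfI a0); apply: (lincomb1 (-1) E2); ring.
have eb : e = b.
  move/eqP: H2; rewrite eqf_sqr => /orP[] /eqP // eb.
  have /eqP := oner_neq0 C; case.
  by rewrite -[LHS]E1 eb; ring.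
rewrite {}eb {H2} in E1 E2 E3 E4 E5 *.
have H1 : 6 * a ^+ 2 * b = 1 by apply: (lincomb1 1 E1); ring.
have b0 : b != 0.
  apply/eqP => b0; have /eqP := oner_neq0 C; apply.
  by rewrite -[LHS]H1 b0; ring.
have H6 : (6 : C) != 0 by rewrite pnatr_eq0.
have : c ^+ 2 = a ^+ 2.
  by apply: (mulfI b0); apply: (mulfI H6); apply: (lincomb2 1 (-1) E5 H1); ring.
case/sqr_sign => t [ts ec]; rewrite ec in E3 *.
exists t => //; exists a, b; split=> //.
by apply: (lincomb2 1 (- 2 * t) E3 H1); ring.
Qed.

Lemma sign_sqr e : is_sign e -> e ^+ 2 = 1.
Proof. by case=> ->; ring. Qed.

(** The x^4 y^2 and x^2 y^4 coefficients are linear equations in ac, b^2 and e^2. Eliminating ac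
    gives e^2 = w b^2 = (w^2 b)^2, and then ac = -b^2. The value of b^6 comes from multiplying the
    x^5 y and x y^5 equations, using (1 + t w^2)(1 + t w) = 2 - t. *)
Lemma rep_shapeII s a b c e : rep (Ps s) (qform a b c) (qform (- a) e (- (w * c))) ->
  exists2 t, is_sign t & shapeII t s (qform a b c) (qform (- a) e (- (w * c))).
Proof.
move=> /rep_sformP[_ [_ E1 E2 [E3 E4 E5 _]]].
have a0 : a != 0.
  apply/eqP => a0; have /eqP := oner_neq0 C; apply.
  by rewrite -[LHS]E1 a0; ring.
have c0 : c != 0.
  apply/eqP => c0; have /eqP := oner_neq0 C; apply.
  by rewrite -[LHS]E5 c0; ring.
have G2 : a * c * (1 - w) = e ^+ 2 - b ^+ 2.
  by apply: (mulfI nz3); apply: (mulfI a0); apply: (lincomb1 1 E2); ring.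
have G4 : a * c * (1 - w ^+ 2) = w * e ^+ 2 - b ^+ 2.
  by apply: (mulfI nz3); apply: (mulfI c0); apply: (lincomb1 1 E4); ring.
have He : e ^+ 2 = w * b ^+ 2.
  by apply: (lincomb2 1 (- (1 + w)) G4 G2); ring.
have : e ^+ 2 = (w ^+ 2 * b) ^+ 2.
  by apply: (lincomb2 1 (- w * b ^+ 2) He w3); ring.
case/sqr_sign => t [ts ee]; have t2 := sign_sqr ts.
have H : a * c = - b ^+ 2.
  have w1 : 1 - w != 0 by rewrite subr_eq0 eq_sym w_neq1.
  by apply: (mulIf w1); apply: (lincomb2 1 1 G2 He); ring.
rewrite ee in E1 E3 E5 *.
have K1 : 3 * a ^+ 2 * b * (1 + t * w ^+ 2) = 1.
  by apply: (lincomb1 1 E1); ring.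
have K5 : 3 * c ^+ 2 * b * (1 + t * w) = 1.
  by apply: (lincomb2 1 (- 3 * c ^+ 2 * b * t * w) E5 w3); ring.
exists t => //; exists a, b, c; split=> //; first by rewrite mulrA.
split=> //.
  have K : 9 * (a * c) ^+ 2 * b ^+ 2 * (1 + t * (w + w ^+ 2) + t ^+ 2 * w ^+ 3) = 1.
    by apply: (lincomb2 (3 * c ^+ 2 * b * (1 + t * w)) 1 K1 K5); ring.
  rewrite -[RHS]K H w3 t2.
  by apply: (lincomb1 (- 9 * b ^+ 6 * t) w_root); ring.
have t3 : t ^+ 3 = t by rewrite exprS t2 mulr1.
have w6 : w ^+ 6 = 1 by rewrite (exprM w 3 2) w3 expr1n.
rewrite -E3.
have -> : b ^+ 3 + 6 * a * b * c + ((t * (w ^+ 2 * b)) ^+ 3 +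
    6 * - a * (t * (w ^+ 2 * b)) * - (w * c)) =
  b ^+ 3 + 6 * (a * c) * b + t ^+ 3 * w ^+ 6 * b ^+ 3 + 6 * (a * c) * t * w ^+ 3 * b by ring.
by rewrite H t3 w6 w3; ring.
Qed.

End Solve.

(** * Reduction of every representation to the two shapes, and the converse *)

Section Count.
Variable C : numClosedFieldType.
Implicit Types (a b c d e s t z w : C) (f g p q : {mpoly C[2]}).
Variable w : C.
Hypothesis w_root : w ^+ 2 + w + 1 = 0.
Let w3 := w3 w_root.
Let nz3 := nz3 C.

Lemma expf3_eq1 z : z ^+ 3 = 1 -> z != 0.
Proof. by move=> z3; apply: contra_eq_neq z3 => ->; rewrite expr0n eq_sym oner_neq0. Qed.

Lemma scale_cube1 z g : z ^+ 3 = 1 -> (z *: g) ^+ 3 = g ^+ 3.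
Proof. by move=> z3; rewrite exprZn z3 scale1r. Qed.

Lemma rep_scale z p f g : z ^+ 3 = 1 -> rep p f g -> rep p f (z *: g).
Proof.
move=> z3 [h1 h2 h3 h4]; split; rewrite ?dhomogZ ?scale_cube1 //.
have z0 := expf3_eq1 z3.
case=> -[t e]; apply: h3.
  by left; exists (t * z); rewrite e scalerA.
by right; exists (z^-1 * t); rewrite -scalerA -e scalerA mulVf // scale1r.
Qed.

Lemma Ps_solve s f g : rep (Ps s) f g -> exists f' g', [/\ rep (Ps s) f' g',
  (f' ^+ 3 = f ^+ 3 /\ g' ^+ 3 = g ^+ 3) \/ (f' ^+ 3 = g ^+ 3 /\ g' ^+ 3 = f ^+ 3) &
  exists2 t, is_sign t & shapeI t s f' g' \/ shapeII w t s f' g'].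
Proof.
move=> r; have [hf hg _ _] := r.
have [a [b [c ef]]] := qformP hf; have [d [e [h eg]]] := qformP hg.
subst f g.
have [_ [E0 _ _ [_ _ _ E6]]] := (rep_sformP _ _ _ _ _ _ _ _ _ _ _ _ _).1 r.
have [z [z3 ed]] : exists z, z ^+ 3 = 1 /\ - a = z * d.
  by apply: cube_eq; apply: (lincomb1 (-1) E0); ring.
have [y [y3 eh]] : exists y, y ^+ 3 = 1 /\ z * h = y * - c.
  apply: cube_eq; rewrite exprMn z3; apply: (lincomb1 1 E6); ring.
have {}r := rep_scale z3 r.
have hc := scale_cube1 (qform d e h) z3.
rewrite qformZ -ed eh in r hc.
have [y1|y1|y1] := cube_root1 w_root y3; subst y.
- rewrite mul1r in r hc.
  exists (qform a b c), (qform (- a) (z * e) (- c)); split=> //; first by left.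
  by have [t ? ?] := rep_shapeI r; exists t => //; left.
- rewrite mulrN in r hc.
  exists (qform a b c), (qform (- a) (z * e) (- (w * c))); split=> //; first by left.
  by have [t ? ?] := rep_shapeII w_root r; exists t => //; right.
- have r' := rep_sym r.
  exists (qform (- a) (z * e) (w ^+ 2 * - c)), (qform a b c); split=> //; first by right.
  move: r'; have -> : qform a b c = qform (- - a) b (- (w * (w ^+ 2 * - c))).
    congr qform; first by rewrite opprK.
    by apply: (lincomb1 (- c) w3); ring.
  by move=> /(rep_shapeII w_root)[t ? ?]; exists t => //; right.
Qed.

Lemma shapeI_rep t s f g : is_sign t -> shapeI t s f g -> rep (Ps s) f g.
Proof.
move=> ts [a [b [-> -> H1 H3]]].
have t2 := sign_sqr ts.
apply/rep_sformP; split=> [[h _ _]|].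
  have /eqP := oner_neq0 C; apply; apply: (lincomb2 (-1) (3 * a) H1 h); ring.
split; [ring| |ring|split; [| ring | | ring]].
- by apply: (lincomb1 1 H1); ring.
- by apply: (lincomb2 1 (2 * t) H3 H1); ring.
- apply: (lincomb2 1 (6 * a ^+ 2 * b) H1 t2); ring.
Qed.

Lemma shapeII_rep t s f g : is_sign t -> shapeII w t s f g -> rep (Ps s) f g.
Proof.
move=> ts [a [b [c [-> -> [H K1 K6 ->]]]]].
have t2 := sign_sqr ts.
have t3 : t ^+ 3 = t by rewrite exprS t2 mulr1.
have w6 : w ^+ 6 = 1 by rewrite (exprM w 3 2) w3 expr1n.
(* The x y^5 equation is recovered from the x^5 y equation and the value of b^6, which encodes the
   product of the two. *)
have K5 : 3 * c ^+ 2 * b * (1 + t * w) = 1.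
  have -> : 3 * c ^+ 2 * b * (1 + t * w) = 3 * a ^+ 2 * b * (1 + t * w ^+ 2) *
     (3 * c ^+ 2 * b * (1 + t * w)) by rewrite K1 mul1r.
  have -> : 3 * a ^+ 2 * b * (1 + t * w ^+ 2) * (3 * c ^+ 2 * b * (1 + t * w)) =
    9 * (a * c) ^+ 2 * b ^+ 2 * (1 + t * (w + w ^+ 2) + t ^+ 2 * w ^+ 3) by ring.
  rewrite -[RHS]K6 H w3 t2.
  by apply: (lincomb1 (9 * b ^+ 6 * t) w_root); ring.
apply/rep_sformP; split=> [[h _ _]|].
  have /eqP := oner_neq0 C; apply.
  apply: (lincomb2 (-1) (3 * a) K1 h); ring.
split; [ring| | |split].
- by apply: (lincomb1 1 K1); ring.
- have -> : 3 * a ^+ 2 * c + 3 * a * b ^+ 2 + (3 * (- a) ^+ 2 * - (w * c) +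
      3 * - a * (t * w ^+ 2 * b) ^+ 2) =
    3 * a * (a * c + b ^+ 2 - w * (a * c) - t ^+ 2 * w ^+ 3 * w * b ^+ 2) by ring.
  by rewrite t2 w3 H; ring.
- have -> : b ^+ 3 + 6 * a * b * c + ((t * w ^+ 2 * b) ^+ 3 +
     6 * - a * (t * w ^+ 2 * b) * - (w * c)) =
   b ^+ 3 + 6 * (a * c) * b + t ^+ 3 * w ^+ 6 * b ^+ 3 + 6 * (a * c) * t * w ^+ 3 * b by ring.
  by rewrite t3 w6 w3 H; ring.
- have -> : 3 * a * c ^+ 2 + 3 * b ^+ 2 * c + (3 * - a * (- (w * c)) ^+ 2 +
     3 * (t * w ^+ 2 * b) ^+ 2 * - (w * c)) =
   3 * c * (a * c + b ^+ 2 - w ^+ 2 * (a * c) - t ^+ 2 * w ^+ 3 * w ^+ 2 * b ^+ 2) by ring.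
  by rewrite t2 w3 H; ring.
- by apply: (lincomb2 1 (3 * b * c ^+ 2 * t * w) K5 w3); ring.
- apply: (lincomb1 (- c ^+ 3) w3); ring.
Qed.

End Count.

(** * Counting the representations *)

Section Count2.
Variable C : numClosedFieldType.
Implicit Types (a b c d e s t z w : C) (f g p q : {mpoly C[2]}).
Variable w : C.
Hypothesis w_root : w ^+ 2 + w + 1 = 0.
Let w3 := w3 w_root.

(** The coefficients of x^6, x^5 y, x^3 y^3 and y^6, by which the cubes are told apart. *)
Definition coefs4 q := (q@_(mon 6 0), q@_(mon 5 1), q@_(mon 3 3), q@_(mon 0 6)).

Lemma coefs4_cube a b c : coefs4 (qform a b c ^+ 3) =
  (a ^+ 3, 3 * a ^+ 2 * b, b ^+ 3 + 6 * a * b * c, c ^+ 3).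
Proof.
by rewrite /coefs4 qform_cube -[mon 6 0]/(mon (6 - 0) 0) -[mon 5 1]/(mon (6 - 1) 1)
  -[mon 3 3]/(mon (6 - 3) 3) -[mon 0 6]/(mon (6 - 6) 6) !sform_coef.
Qed.

Lemma coefs4_Ps q r s : q + r = Ps s -> let: (u0, u1, u3, u6) := coefs4 q in
  let: (v0, v1, v3, v6) := coefs4 r in [/\ u0 + v0 = 0, u1 + v1 = 1 & u6 + v6 = 0].
Proof.
rewrite /coefs4 => h; rewrite -!mcoeffD h -[mon 6 0]/(mon (6 - 0) 0) -[mon 5 1]/(mon (6 - 1) 1)
  -[mon 0 6]/(mon (6 - 6) 6) !sform_coef //.
Qed.

(** Shape I splits the x^5 y coefficient 1 of [Ps s] evenly between the two cubes, and its sign is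
    the ratio of the y^6 to the x^6 coefficient. Both cubes of such a pair have these properties, so
    they rule out equal and complementary cubes alike. *)
Definition tagI e q := let: (u0, u1, u3, u6) := coefs4 q in
  [/\ u0 != 0, 2 * u1 = 1 & u6 = e * u0].

Definition tagII e q := (1 + e * w ^+ 2) * (coefs4 q).1.1.2 = 1.

Lemma shapeI_tag e s f g : is_sign e -> shapeI e s f g -> tagI e (f ^+ 3).
Proof.
move=> es [a [b [-> _ H _]]]; rewrite /tagI coefs4_cube; split.
- rewrite expf_neq0 //; apply/eqP => a0; have /eqP := oner_neq0 C; apply.
  by rewrite -[LHS]H a0; ring.
- by apply: (lincomb1 1 H); ring.
- by rewrite exprMn exprS sign_sqr // mulr1.
Qed.

Lemma shapeII_tag e s f g : shapeII w e s f g -> tagII e (f ^+ 3).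
Proof.
move=> [a [b [c [-> _ [_ H _ _]]]]]; rewrite /tagII coefs4_cube /=.
by apply: (lincomb1 1 H); ring.
Qed.

(** An even split would mean e w^2 = 1; cubing gives e = 1, and then w = 1. *)
Lemma tagII_neq e q : is_sign e -> tagII e q -> 2 * (coefs4 q).1.1.2 != 1.
Proof.
rewrite /tagII; move: (_.2) => k es h; apply/eqP => h2.
have H : e * w ^+ 2 = 1 by apply: (lincomb2 2 (- (1 + e * w ^+ 2)) h h2); ring.
have w6 : w ^+ 6 = 1 by rewrite (exprM w 3 2) w3 expr1n.
have H3 : e ^+ 3 * w ^+ 6 = 1 by rewrite (exprM w 2 3) -exprMn H expr1n.
move: H3; rewrite w6 exprS sign_sqr // !mulr1 => e1.
have /eqP := w_neq1 w_root; apply.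
by apply: (lincomb2 1 (- w) w3 H); rewrite e1; ring.
Qed.

Lemma tagI_tagI e q r s : is_sign e -> tagI e q -> tagI (- e) r -> q != r /\ q + r != Ps s.
Proof.
move=> es; rewrite /tagI => hq hr; split; apply/eqP => h.
  move: hq hr; rewrite h; case: (coefs4 r) => [[[u0 u1] u3] u6] [n0 _ ->] [_ _ /eqP].
  rewrite mulNr -addr_eq0 -mulr2n mulrn_eq0 /= mulf_eq0 (negPf n0) orbF.
  by case: es => ->; rewrite ?oppr_eq0 oner_eq0.
move: (coefs4_Ps h) hq hr.
case: (coefs4 q) (coefs4 r) => [[[u0 u1] u3] u6] [[[v0 v1] v3] v6] [h0 _ h6].
move=> [n0 _ e6] [_ _ e6']; move/eqP: n0; apply.
move: h6; rewrite e6 e6' => h6; have n2 : (2 : C) != 0 by rewrite pnatr_eq0.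
apply: (mulfI n2).
apply: (lincomb2 1 e h0 h6); by case: es => ->; ring.
Qed.

Lemma tagI_double e q s : tagI e q -> q + q != Ps s.
Proof.
rewrite /tagI => hq; apply/eqP => h; move: (coefs4_Ps h) hq.
case: (coefs4 q) => [[[u0 u1] u3] u6] [h0 _ _] [n0 _ _].
by move/eqP: h0; rewrite -mulr2n mulrn_eq0 /= (negPf n0).
Qed.

Lemma tagI_tagII e e' q r s : is_sign e' -> tagI e q -> tagII e' r ->
  q != r /\ q + r != Ps s.
Proof.
move=> es hq /(tagII_neq es) hr; split; apply/eqP => h.
  move: hq hr; rewrite h /tagI; case: (coefs4 r) => [[[u0 u1] u3] u6] [_ hu _].
  by rewrite /= hu eqxx.
move: (coefs4_Ps h) hq hr; rewrite /tagI.
case: (coefs4 q) (coefs4 r) => [[[u0 u1] u3] u6] [[[v0 v1] v3] v6] [_ h1 _] [_ h2 _] /= /eqP.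
by apply; apply: (lincomb2 2 (- 1) h1 h2); ring.
Qed.

(** The tag fixes the x^5 y coefficient of both cubes to one value, whose double is not 1. *)
Lemma tagII_tagII e q r s : is_sign e -> tagII e q -> tagII e r -> q + r != Ps s.
Proof.
move=> es hq hr; have /eqP hq2 := tagII_neq es hq; apply/eqP => h; apply: hq2.
move: (coefs4_Ps h) hq hr; rewrite /tagII.
case: (coefs4 q) (coefs4 r) => [[[u0 u1] u3] u6] [[[v0 v1] v3] v6] /= [_ h1 _] hu hv.
have n0 : 1 + e * w ^+ 2 != 0.
  by apply: contra_eq_neq hu => ->; rewrite mul0r eq_sym oner_neq0.
have uv : u1 = v1 by apply: (mulfI n0); rewrite hu hv.
by apply: (lincomb1 1 h1); rewrite uv; ring.
Qed.

(** The second clause accepts either cube because exchanging f and g maps shape I to itself, with -a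
    in place of a. *)
Definition list_of (P : {mpoly C[2]} -> {mpoly C[2]} -> Prop) (l : seq {mpoly C[2]}) :=
  [/\ forall q, q \in l -> exists f g, P f g /\ q = f ^+ 3,
      forall f g, P f g -> f ^+ 3 \in l \/ g ^+ 3 \in l & uniq l].

(** Shape I may occur for both signs, with at most one pair each, while shape II is assumed to occur
    only for the sign e. The tags separate the three lists; inside a shape I list the only sum to
    exclude is that of its single cube with itself. *)
Lemma N_Ps s e l1 l2 l3 : is_sign e ->
  list_of (shapeI 1 s) l1 -> (size l1 <= 1)%N ->
  list_of (shapeI (-1) s) l2 -> (size l2 <= 1)%N ->
  list_of (shapeII w e s) l3 -> (forall f g, ~ shapeII w (- e) s f g) ->
  N_is (Ps s) (size (l1 ++ l2 ++ l3)).
Proof.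
move=> es [a1 b1 u1] z1 [a2 b2 u2] z2 [a3 b3 u3] no3.
have s1 : is_sign (1 : C) by left.
have sN1 : is_sign (-1 : C) by right.
have t1 q : q \in l1 -> tagI 1 q.
  by move=> /a1[f [g [h ->]]]; apply: shapeI_tag h.
have t2 q : q \in l2 -> tagI (-1) q.
  by move=> /a2[f [g [h ->]]]; apply: shapeI_tag h.
have t3 q : q \in l3 -> tagII e q.
  by move=> /a3[f [g [h ->]]]; apply: shapeII_tag h.
have small (l : seq {mpoly C[2]}) q r : (size l <= 1)%N -> q \in l -> r \in l -> q = r.
  by case: l => [|x [|]] // _; rewrite !inE => /eqP -> /eqP ->.
apply: N_is_seq.
- move=> q; rewrite !mem_cat => /or3P[] => [/a1|/a2|/a3] [f [g [h ->]]]; exists f, g; split=> //.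
  + exact: shapeI_rep h.
  + exact: shapeI_rep h.
  + exact: shapeII_rep h.
- move=> f g /(Ps_solve w_root)[f' [g' [_ cubes [t ts sh]]]].
  have : f' ^+ 3 \in l1 ++ l2 ++ l3 \/ g' ^+ 3 \in l1 ++ l2 ++ l3.
    rewrite !mem_cat; case: sh => sh.
      case: ts sh => -> => [/b1|/b2] [] ->; rewrite ?orbT; by [left|right].
    have te : t = e.
      apply: contrapT => te; apply: (no3 f' g').
      by case: ts es te sh => -> [->|->] // _; rewrite ?opprK.
    by move: sh; rewrite te => /b3[] ->; rewrite !orbT; [left|right].
  by case: cubes => -[-> ->]; tauto.
- rewrite !cat_uniq u1 u2 u3 /= andbT; apply/andP; split.
    apply/hasPn => q; rewrite mem_cat => /orP[] hq; apply/negP => hq'.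
      by have [/eqP] := tagI_tagI s s1 (t1 _ hq') (t2 _ hq).
    by have [/eqP] := tagI_tagII s es (t1 _ hq') (t3 _ hq).
  apply/hasPn => q hq; apply/negP => hq'.
  by have [/eqP] := tagI_tagII s es (t2 _ hq') (t3 _ hq).
- move=> q r; rewrite !mem_cat => /or3P[] hq /or3P[] hr.
  + by rewrite (small _ _ _ z1 hq hr); apply: (tagI_double _ (t1 _ hr)).
  + by have [] := tagI_tagI s s1 (t1 _ hq) (t2 _ hr).
  + by have [] := tagI_tagII s es (t1 _ hq) (t3 _ hr).
  + by rewrite addrC; have [] := tagI_tagI s s1 (t1 _ hr) (t2 _ hq).
  + by rewrite (small _ _ _ z2 hq hr); apply: (tagI_double _ (t2 _ hr)).
  + by have [] := tagI_tagII s es (t2 _ hq) (t3 _ hr).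
  + by rewrite addrC; have [] := tagI_tagII s es (t1 _ hr) (t3 _ hq).
  + by rewrite addrC; have [] := tagI_tagII s es (t2 _ hr) (t3 _ hq).
  + exact: tagII_tagII (t3 _ hq) (t3 _ hr).
Qed.

End Count2.

(** * Enumeration of the solutions of each shape *)

Section Lists.
Variable C : numClosedFieldType.
Implicit Types (a b c d e s t z w : C) (f g p q : {mpoly C[2]}).

Lemma qform_cube_scale z a b c : z ^+ 3 = 1 ->
  qform (z * a) (z * b) (z * c) ^+ 3 = qform a b c ^+ 3.
Proof. by move=> z3; rewrite -qformZ scale_cube1. Qed.

(** The value of b^3 is prescribed, and 6 a^2 b = 1 then fixes a^2. Another cube root for b only
    multiplies f and g by a root of unity, and the other sign of a exchanges their cubes: one pair
    remains, unless b = 0. *)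
Lemma listI e s : is_sign e ->
  exists2 l, list_of (shapeI e s) l & size l = (s != 2 * e).
Proof.
move=> es; have [s0|s0] := eqVneq s (2 * e).
  exists [::] => //; split=> // f g [a [b [_ _ H1 /eqP]]].
  rewrite s0 subrr mulf_eq0 pnatr_eq0 expf_eq0 /= => /eqP b0.
  by have /eqP := oner_neq0 C; case; rewrite -[LHS]H1 b0; ring.
have n2 : (2 : C) != 0 by rewrite pnatr_eq0.
have n6 : (6 : C) != 0 by rewrite pnatr_eq0.
pose b0 : C := 3.-root ((s - 2 * e) / 2).
have hb : b0 ^+ 3 = (s - 2 * e) / 2 by rewrite rootCK.
have b0n : b0 != 0.
  by rewrite rootC_eq0 // mulf_neq0 ?invr_eq0 // subr_eq0.
pose a0 : C := sqrtC (6 * b0)^-1.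
have ha : a0 ^+ 2 = (6 * b0)^-1 by rewrite sqrtCK.
exists [:: qform a0 b0 (e * a0) ^+ 3] => //; split=> //.
  move=> q; rewrite inE => /eqP ->.
  exists (qform a0 b0 (e * a0)), (qform (- a0) b0 (- (e * a0))); split=> //.
  exists a0, b0; split=> //.
    by rewrite ha; field; rewrite b0n.
  by rewrite hb; field.
move=> f g [a [b [-> -> H1 H3]]].
have [z [z3 bz]] : exists z, z ^+ 3 = 1 /\ b = z * b0.
  apply: cube_eq; apply: (mulfI n2); rewrite H3 hb; by field.
have z0 := expf3_eq1 z3.
have : (a / z) ^+ 2 = a0 ^+ 2.
  apply: (mulIf (mulf_neq0 n6 b0n)); rewrite ha mulVf ?mulf_neq0 //.
  have zz : z^-1 = z ^+ 2 by apply: (mulIf z0); rewrite mulVf // -exprSr.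
  by rewrite -[RHS]H1 bz zz; apply: (lincomb1 (6 * a ^+ 2 * b0 * z) z3); ring.
move/eqP; rewrite eqf_sqr => /orP[] /eqP ea.
  left; rewrite inE; apply/eqP; have -> : a = z * a0 by rewrite -ea mulrC divfK.
  by rewrite bz mulrCA qform_cube_scale.
right; rewrite inE; apply/eqP; have -> : a = - (z * a0).
  by rewrite -mulrN -ea mulrC divfK.
by rewrite bz mulrN !opprK mulrCA qform_cube_scale.
Qed.

Variable w : C.
Hypothesis w_root : w ^+ 2 + w + 1 = 0.
Let w3 := w3 w_root.

(** Once b^3 is chosen, a cube root of unity in b is absorbed by scaling f, c follows from ac =
    -b^2, and a is determined up to sign. Unlike in shape I, the two signs give different pairs. *)
Lemma pairII e s b0 : is_sign e -> 9 * b0 ^+ 6 * (2 - e) = 1 -> s = - 5 * (1 + e) * b0 ^+ 3 ->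
  exists a c, [/\ a != 0, a * c = - b0 ^+ 2,
   shapeII w e s (qform a b0 c) (qform (- a) (e * w ^+ 2 * b0) (- (w * c))),
   shapeII w e s (qform (- a) b0 (- c)) (qform a (e * w ^+ 2 * b0) (w * c)) &
   forall f g, shapeII w e s f g -> f@_(mon 1 1) ^+ 3 = b0 ^+ 3 ->
     f ^+ 3 = qform a b0 c ^+ 3 \/ f ^+ 3 = qform (- a) b0 (- c) ^+ 3].
Proof.
move=> es hb hs.
have n3 := nz3 C.
have b0n : b0 != 0.
  by apply: contra_eq_neq hb => ->; rewrite expr0n /= mulr0 mul0r eq_sym oner_neq0.
(* This is a factor of 2 - e, which is nonzero by [hb]. *)
have kn : 1 + e * w ^+ 2 != 0.
  apply/eqP => k0; have /eqP := oner_neq0 C; apply.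
  rewrite -[LHS]hb; have e2 := sign_sqr es.
  apply: (lincomb2 (9 * b0 ^+ 6 * (1 + e * w)) (- 9 * b0 ^+ 6 * e) k0 w_root).
  by case: es => ->; apply: (lincomb1 (- 9 * b0 ^+ 6) w3); ring.
pose a0 : C := sqrtC (3 * b0 * (1 + e * w ^+ 2))^-1.
have ha : a0 ^+ 2 = (3 * b0 * (1 + e * w ^+ 2))^-1 by rewrite sqrtCK.
have a0n : a0 != 0 by rewrite sqrtC_eq0 invr_eq0 !mulf_neq0.
have hac : a0 * (- b0 ^+ 2 / a0) = - b0 ^+ 2 by rewrite mulrC divfK.
have hab : 3 * a0 ^+ 2 * b0 * (1 + e * w ^+ 2) = 1.
  by rewrite ha; field; rewrite kn b0n.
exists a0, (- b0 ^+ 2 / a0); split=> //.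
- by exists a0, b0, (- b0 ^+ 2 / a0).
- exists (- a0), b0, (- (- b0 ^+ 2 / a0)); split=> //; first by rewrite !mulrN !opprK.
  by split=> //; rewrite ?mulrNN // sqrrN.
move=> f g [a [b [c [-> _ [H K1 K6 _]]]]]; have [_ -> _] := qform_coef a b c.
move=> /cube_eq[z [z3 bz]]; have z0 := expf3_eq1 z3.
have zz : z^-1 = z ^+ 2 by apply: (mulIf z0); rewrite mulVf // -exprSr.
have : (a / z) ^+ 2 = a0 ^+ 2.
  apply: (mulIf (mulf_neq0 (mulf_neq0 n3 b0n) kn)); rewrite ha mulVf ?mulf_neq0 //.
  rewrite -[RHS]K1 bz zz.
  apply: (lincomb1 (3 * a ^+ 2 * b0 * z * (1 + e * w ^+ 2)) z3); ring.
have cE x : x != 0 -> a = z * x -> c = z * (- b0 ^+ 2 / x).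
  move=> x0 ax; apply: (mulfI (mulf_neq0 z0 x0)).
  by rewrite -ax H bz ax; field.
move/eqP; rewrite eqf_sqr => /orP[] /eqP ea.
  left; have ax : a = z * a0 by rewrite -ea mulrC divfK.
  by rewrite (cE _ a0n ax) ax bz qform_cube_scale.
right; have ax : a = z * - a0 by rewrite -ea mulrC divfK.
by rewrite (cE _ _ ax) ?oppr_eq0 // ax bz qform_cube_scale // invrN mulrN.
Qed.

Lemma list_nil (P : {mpoly C[2]} -> {mpoly C[2]} -> Prop) : (forall f g, ~ P f g) -> list_of P [::].
Proof. by move=> h; split=> // f g /h. Qed.

Lemma shapeII_mid e s f g : shapeII w e s f g ->
  9 * f@_(mon 1 1) ^+ 6 * (2 - e) = 1 /\ s = - 5 * (1 + e) * f@_(mon 1 1) ^+ 3.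
Proof.
by move=> [a [b [c [-> _ [_ _ H ->]]]]]; have [_ -> _] := qform_coef a b c.
Qed.

Lemma shapeII_pos s f g : shapeII w 1 s f g -> 9 * s ^+ 2 = 100.
Proof.
move=> /shapeII_mid[]; move: (_@__) => b H ->.
by apply: (lincomb1 100 H); ring.
Qed.

Lemma shapeII_neg s f g : shapeII w (-1) s f g -> s = 0.
Proof. by move=> /shapeII_mid[_ ->]; ring. Qed.

Lemma neq_oppf a : a != 0 -> a != - a.
Proof. by move=> a0; rewrite -addr_eq0 -mulr2n mulrn_eq0. Qed.

Lemma cube_neq a b c a' b' c' :
  a ^+ 3 != a' ^+ 3 \/ b ^+ 3 + 6 * a * b * c != b' ^+ 3 + 6 * a' * b' * c' ->
  qform a b c ^+ 3 != qform a' b' c' ^+ 3.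
Proof.
move=> h; apply/eqP => /(congr1 (@coefs4 C)); rewrite !coefs4_cube => -[e0 _ e3 _].
by case: h => /eqP.
Qed.

(** For e = 1 the relation s = -10 b^3 determines b^3, leaving the two signs of a. *)
Lemma listII_pos s : 9 * s ^+ 2 = 100 -> exists2 l, list_of (shapeII w 1 s) l & size l = 2%N.
Proof.
move=> hs; pose b0 : C := 3.-root (- s / 10).
have n10 : (10 : C) != 0 by rewrite pnatr_eq0.
have hb : b0 ^+ 3 = - s / 10 by rewrite rootCK.
have hb6 : 9 * b0 ^+ 6 * (2 - 1) = 1.
  have -> : 9 * b0 ^+ 6 * (2 - 1) = 9 * (b0 ^+ 3) ^+ 2 by ring.
  rewrite hb; have -> : 9 * (- s / 10) ^+ 2 = (9 * s ^+ 2) / 100 by field.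
  by rewrite hs divff // pnatr_eq0.
have hs' : s = - 5 * (1 + 1) * b0 ^+ 3 by rewrite hb; field.
have [a [c [an _ s1 s2 all]]] := pairII (or_introl erefl) hb6 hs'.
exists [:: qform a b0 c ^+ 3; qform (- a) b0 (- c) ^+ 3] => //; split.
- by move=> q; rewrite !inE => /orP[] /eqP ->; do 2 eexists; (split; last reflexivity); eassumption.
- move=> f g sh; left; rewrite !inE; apply/orP.
  have [_ hm] := shapeII_mid sh.
  have : f@_(mon 1 1) ^+ 3 = b0 ^+ 3.
    by apply: (mulfI n10); apply: (lincomb2 (-1) 1 hs' hm); ring.
  by case/(all _ _ sh) => ->; [left|right].
- rewrite /= inE andbT; apply: cube_neq; left.
  by rewrite exprNn -signr_odd /= expr1 mulN1r neq_oppf // expf_neq0.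
Qed.

(** For e = -1 the relation between s and b degenerates to s = 0, and 27 b^6 = 1 leaves two opposite
    values of b^3, each with two signs of a. *)
Lemma listII_neg : exists2 l, list_of (shapeII w (-1) 0) l & size l = 4%N.
Proof.
pose b0 : C := 6.-root (27^-1).
have n27 : (27 : C) != 0 by rewrite pnatr_eq0.
have n5 : (5 : C) != 0 by rewrite pnatr_eq0.
have hb : b0 ^+ 6 = 27^-1 by rewrite rootCK.
have b0n : b0 != 0 by rewrite rootC_eq0 // invr_eq0.
have hb1 : 9 * b0 ^+ 6 * (2 - -1) = 1 by rewrite hb; field.
have hb2 : 9 * (- b0) ^+ 6 * (2 - -1) = 1 by rewrite -[RHS]hb1; ring.
have hs b : 0 = - 5 * (1 + -1) * b ^+ 3 by ring.
have [a [c [an hac s1 s2 all]]] := pairII (or_intror erefl) hb1 (hs _).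
have [a' [c' [an' hac' s1' s2' all']]] := pairII (or_intror erefl) hb2 (hs _).
exists [:: qform a b0 c ^+ 3; qform (- a) b0 (- c) ^+ 3;
  qform a' (- b0) c' ^+ 3; qform (- a') (- b0) (- c') ^+ 3] => //; split.
- by move=> q; rewrite !inE => /or4P[] /eqP ->; do 2 eexists; (split; last reflexivity); eassumption.
- move=> f g sh; left; rewrite !inE; apply/or4P.
  have [hm _] := shapeII_mid sh.
  have : (f@_(mon 1 1) ^+ 3) ^+ 2 = (b0 ^+ 3) ^+ 2.
    by apply: (mulfI n27); apply: (lincomb2 1 (-1) hm hb1); ring.
  move/eqP; rewrite eqf_sqr => /orP[] /eqP e.
    case: (all _ _ sh e) => ->; by [constructor 1|constructor 2].
  have e' : f@_(mon 1 1) ^+ 3 = (- b0) ^+ 3 by rewrite e; ring.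
  case: (all' _ _ sh e') => ->; by [constructor 3|constructor 4].
- have opp3 (x : C) : (- x) ^+ 3 = - x ^+ 3 by ring.
  (* Since ac = -b^2, the x^3 y^3 coefficient of the cube is -5 b^3, which separates b0 from -b0;
     the x^6 coefficient separates the signs of a. *)
  have mid (x b y : C) : x * y = - b ^+ 2 -> b ^+ 3 + 6 * x * b * y = - 5 * b ^+ 3.
    by move=> h; apply: (lincomb1 (6 * b) h); ring.
  have m1 := mid _ _ _ hac.
  have m2 : b0 ^+ 3 + 6 * - a * b0 * - c = - 5 * b0 ^+ 3 by rewrite -m1; ring.
  have m3 := mid _ _ _ hac'.
  have m4 : (- b0) ^+ 3 + 6 * - a' * - b0 * - c' = - 5 * (- b0) ^+ 3 by rewrite -m3; ring.
  have nb : - 5 * b0 ^+ 3 != - 5 * (- b0) ^+ 3.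
    by rewrite opp3 mulrN neq_oppf // mulf_neq0 ?oppr_eq0 ?expf_neq0.
  rewrite /= !inE !negb_or !andbT -!andbA; apply/and5P; split; last (apply/andP; split);
    apply: cube_neq; rewrite ?m1 ?m2 ?m3 ?m4; try by right.
    by left; rewrite opp3 neq_oppf // expf_neq0.
  by left; rewrite opp3 neq_oppf // expf_neq0.
Qed.

Lemma N_Ps_size s e n : is_sign e -> (exists2 l, list_of (shapeII w e s) l & size l = n) ->
  (forall f g, ~ shapeII w (- e) s f g) -> N_is (Ps s) ((s != 2)%R + (s != -2)%R + n).
Proof.
move=> es [l3 h3 <-] no.
have [l1 h1 z1] := listI s (or_introl erefl).
have [l2 h2 z2] := listI s (or_intror erefl).
have := N_Ps w_root es h1 _ h2 _ h3 no.
rewrite !size_cat z1 z2 mulr1 mulrN1 addnA.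
by apply; apply: leq_b1.
Qed.

Lemma N_Ps_generic s : s != 2 -> s != -2 -> s != 0 -> 9 * s ^+ 2 != 100 -> N_is (Ps s) 2.
Proof.
move=> h1 h2 /eqP h3 /eqP h4; have := @N_Ps_size s 1 0 (or_introl erefl).
rewrite h1 h2; apply; last by move=> f g /shapeII_neg.
by exists [::] => //; apply: list_nil => f g /shapeII_pos.
Qed.

Lemma N_Ps_2 : N_is (Ps (2 : C)) 1.
Proof.
have := @N_Ps_size 2 1 0 (or_introl erefl).
have -> : (2 != -2 :> C) by rewrite neq_oppf // pnatr_eq0.
rewrite eqxx; apply; last first.
  by move=> f g /shapeII_neg/eqP; rewrite pnatr_eq0.
exists [::] => //; apply: list_nil => f g /shapeII_pos/eqP.
by rewrite -natrX -natrM eqr_nat.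
Qed.

Lemma N_Ps_0 : N_is (Ps (0 : C)) 6.
Proof.
have := @N_Ps_size 0 (-1) 4 (or_intror erefl) listII_neg.
have -> : (0 != 2 :> C) by rewrite eq_sym pnatr_eq0.
have -> : (0 != -2 :> C) by rewrite eq_sym oppr_eq0 pnatr_eq0.
rewrite opprK; apply.
by move=> f g /shapeII_pos/eqP; rewrite expr0n mulr0 eq_sym pnatr_eq0.
Qed.

Lemma N_Ps_hex s : 9 * s ^+ 2 = 100 -> N_is (Ps s) 4.
Proof.
move=> hs; have := @N_Ps_size s 1 2 (or_introl erefl) (listII_pos hs).
have -> : s != 2.
  by apply: contra_eq_neq hs => ->; rewrite -natrX -natrM eqr_nat.
have -> : s != -2.
  by apply: contra_eq_neq hs => ->; rewrite sqrrN -natrX -natrM eqr_nat.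
apply; move=> f g /shapeII_neg s0; move: hs; rewrite s0 expr0n mulr0 => /esym/eqP.
by rewrite pnatr_eq0.
Qed.

End Lists.

(** * Pencils of quadratic forms *)

Section Two.
Local Open Scope classical_set_scope.
Variable C : numClosedFieldType.
Implicit Types (a b c d e s t z w : C) (f g p q u v : {mpoly C[2]}).

Let n3 : (3 : C) != 0 := nz3 C.
Let n2 : (2 : C) != 0. Proof. by rewrite pnatr_eq0. Qed.

Lemma exists_omega : exists w : C, w ^+ 2 + w + 1 = 0.
Proof.
exists ((sqrtC (-3) - 1) / 2).
have -> : ((sqrtC (-3) - 1) / 2) ^+ 2 + (sqrtC (-3) - 1) / 2 + 1 =
  (sqrtC (-3) ^+ 2 + 3) / 4 :> C by field.
by rewrite sqrtCK addNr mul0r.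
Qed.

(* In coordinates where the two linear forms on one side are x and y, the mixed coefficients
   of (alpha x + beta y)^3 + (gamma x + delta y)^3 vanish only for monomial matrices. *)
Lemma sum_cubes_unique (a c d f a' c' d' f' : C) : a * f - c * d != 0 -> a' * f' - c' * d' != 0 ->
  a' ^+ 3 + d' ^+ 3 = a ^+ 3 + d ^+ 3 ->
  a' ^+ 2 * c' + d' ^+ 2 * f' = a ^+ 2 * c + d ^+ 2 * f ->
  a' * c' ^+ 2 + d' * f' ^+ 2 = a * c ^+ 2 + d * f ^+ 2 ->
  c' ^+ 3 + f' ^+ 3 = c ^+ 3 + f ^+ 3 ->
  exists z y, [/\ z ^+ 3 = 1, y ^+ 3 = 1 &
    [/\ a' = z * a, c' = z * c, d' = y * d & f' = y * f] \/
    [/\ a' = z * d, c' = z * f, d' = y * a & f' = y * c]].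
Proof.
move=> D0 D1 h0 h1 h2 h3.
(* Cramer's rule: the new linear forms in the basis of the old ones. *)
pose al := (a' * f - c' * d) / (a * f - c * d).
pose be := (a * c' - c * a') / (a * f - c * d).
pose ga := (d' * f - f' * d) / (a * f - c * d).
pose de := (a * f' - c * d') / (a * f - c * d).
have ea : a' = al * a + be * d by rewrite /al /be; field.
have ec : c' = al * c + be * f by rewrite /al /be; field.
have ed : d' = ga * a + de * d by rewrite /ga /de; field.
have ef : f' = ga * c + de * f by rewrite /ga /de; field.
have D2 : al * de - be * ga != 0.
  apply: contra_neq D1 => D2; rewrite ea ec ed ef.
  by apply: (lincomb1 (a * f - c * d) D2); ring.
clearbody al be ga de.
have H (X Y : C) : (al * X + be * Y) ^+ 3 + (ga * X + de * Y) ^+ 3 = X ^+ 3 + Y ^+ 3.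
  pose x := (f * X - c * Y) / (a * f - c * d); pose y := (a * Y - d * X) / (a * f - c * d).
  have eX : X = a * x + c * y by rewrite /x /y; field.
  have eY : Y = d * x + f * y by rewrite /x /y; field.
  clearbody x y; rewrite eX eY.
  have -> : (al * (a * x + c * y) + be * (d * x + f * y)) = a' * x + c' * y by rewrite ea ec; ring.
  have -> : (ga * (a * x + c * y) + de * (d * x + f * y)) = d' * x + f' * y by rewrite ed ef; ring.
  have -> : (a' * x + c' * y) ^+ 3 + (d' * x + f' * y) ^+ 3 = (a' ^+ 3 + d' ^+ 3) * x ^+ 3 +
     3 * (a' ^+ 2 * c' + d' ^+ 2 * f') * x ^+ 2 * y +
     3 * (a' * c' ^+ 2 + d' * f' ^+ 2) * x * y ^+ 2 + (c' ^+ 3 + f' ^+ 3) * y ^+ 3 by ring.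
  by rewrite h0 h1 h2 h3; ring.
have H10 : al ^+ 3 + ga ^+ 3 = 1 by apply: (lincomb1 1 (H 1 0)); ring.
have H01 : be ^+ 3 + de ^+ 3 = 1 by apply: (lincomb1 1 (H 0 1)); ring.
have n6 : (6 : C) != 0 by rewrite pnatr_eq0.
(* The mixed coefficients are extracted by evaluating at (1,1), (1,-1) and a coordinate point. *)
have P1 : al ^+ 2 * be + ga ^+ 2 * de = 0.
  by apply: (mulfI n6); apply: (lincomb3 1 (-1) (-2) (H 1 1) (H 1 (-1)) H01); ring.
have P2 : al * be ^+ 2 + ga * de ^+ 2 = 0.
  by apply: (mulfI n6); apply: (lincomb3 1 1 (-2) (H 1 1) (H 1 (-1)) H10); ring.
have Z1 : al * be = 0.
  by apply: (mulIf D2); apply: (lincomb2 de (- ga) P1 P2); ring.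
have Z2 : ga * de = 0.
  by apply: (mulIf D2); apply: (lincomb2 (- be) al P1 P2); ring.
move/eqP: Z1; rewrite mulf_eq0 => /orP[] /eqP z1; move/eqP: Z2; rewrite mulf_eq0 => /orP[] /eqP z2.
- by move/eqP: D2; rewrite z1 z2; case; ring.
- exists be, ga; split.
  + by apply: (lincomb1 1 H01); rewrite z2; ring.
  + by apply: (lincomb1 1 H10); rewrite z1; ring.
  + by right; rewrite ea ec ed ef z1 z2; split; ring.
- exists al, de; split.
  + by apply: (lincomb1 1 H10); rewrite z2; ring.
  + by apply: (lincomb1 1 H01); rewrite z1; ring.
  + by left; rewrite ea ec ed ef z1 z2; split; ring.
- by move/eqP: D2; rewrite z1 z2; case; ring.
Qed.

End Two.

Section Pencils.
Local Open Scope classical_set_scope.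
Variable C : numClosedFieldType.
Implicit Types (p q u v : {mpoly C[2]}).

Let n3 : (3 : C) != 0 := nz3 C.
Let n2 : (2 : C) != 0. Proof. by rewrite pnatr_eq0. Qed.

Lemma rep_qform p (f g : {mpoly C[2]}) : rep p f g -> exists a b c d e h : C,
  f = qform a b c /\ g = qform d e h.
Proof.
case=> /qformP[a [b [c ->]]] /qformP[d [e [h ->]]] _ _.
by exists a, b, c, d, e, h.
Qed.

(** The points (p1 : p2) and (q1 : q2) are the projective roots of h0 x^2 + h1 xy + h2 y^2. When h0
    = 0 one of them is (1 : 0); otherwise the quadratic formula applies. *)
Lemma factor_quadratic (h0 h1 h2 : C) : ~ [/\ h0 = 0, h1 = 0 & h2 = 0] ->
  exists m p1 p2 q1 q2 : C, [/\ m != 0, h0 = m * (p2 * q2),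
    h1 = - m * (p1 * q2 + p2 * q1), h2 = m * (p1 * q1) &
    (p1 != 0 \/ p2 != 0) /\ (q1 != 0 \/ q2 != 0)].
Proof.
move=> h; have [h00|h00] := eqVneq h0 0.
  exists 1, 1, 0, h2, (- h1); rewrite oner_neq0; split=> //; rewrite ?h00; try ring.
  split; first by left.
  have [h20|] := eqVneq h2 0; last by left.
  right; rewrite oppr_eq0; apply/eqP => h10; exact: h.
pose r : C := sqrtC (h1 ^+ 2 - 4 * h0 * h2).
have hr : r ^+ 2 = h1 ^+ 2 - 4 * h0 * h2 by rewrite sqrtCK.
exists h0, ((- h1 + r) / (2 * h0)), 1, ((- h1 - r) / (2 * h0)), 1.
split; rewrite ?oner_neq0 //; [ring|by field; rewrite h00| |by split; right].
have -> : h0 * ((- h1 + r) / (2 * h0) * ((- h1 - r) / (2 * h0))) = (h1 ^+ 2 - r ^+ 2) / (4 * h0).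
  by field; rewrite h00.
by rewrite hr; field; rewrite h00.
Qed.

(** Half the Jacobian has the coefficients ae - bd, 2(ah - cd), bh - ce, which do not all vanish
    because the forms are not proportional. Two distinct roots, taken as the new basis, remove both
    xy coefficients; a double root, moved to (1,0), removes both x^2 coefficients. *)
Lemma pencil_normal_form p (f g : {mpoly C[2]}) : rep p f g ->
  exists q, similar_forms p q /\
    ((exists a c d h : C, rep q (qform a 0 c) (qform d 0 h)) \/
     (exists b c e h : C, rep q (qform 0 b c) (qform 0 e h))).
Proof.
move=> r; have [a [b [c [d [e [h [ef eg]]]]]]] := rep_qform r; subst f g.
have [_ _ np _] := r.
have : ~ [/\ a * e - b * d = 0, 2 * (a * h - c * d) = 0 & b * h - c * e = 0].
  move=> [h0 /eqP]; rewrite mulf_eq0 (negPf n2) /= => /eqP h1 h2; apply: np.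
  by apply/qform_proportional; split; apply/eqP; rewrite -subr_eq0; apply/eqP.
case/factor_quadratic => m [p1 [p2 [q1 [q2 [m0 h0 h1 h2 [pn qn]]]]]].
(* the polarization of the pencil vanishes at the roots of its Jacobian *)
have F : 2 * a * p1 * q1 + b * (p1 * q2 + q1 * p2) + 2 * c * p2 * q2 = 0.
  apply: (mulfI m0); apply: (lincomb3 (-2 * c) b (-2 * a) h0 h1 h2); ring.
have G : 2 * d * p1 * q1 + e * (p1 * q2 + q1 * p2) + 2 * h * p2 * q2 = 0.
  apply: (mulfI m0); apply: (lincomb3 (-2 * h) e (-2 * d) h0 h1 h2); ring.
have [D|D] := eqVneq (p1 * q2 - q1 * p2) 0; last first.
  exists (lin p1 q1 p2 q2 p); split; first by exists p1, q1, p2, q2.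
  left; have := lin_rep D r; rewrite !lin_qform.
  have -> : 2 * a * p1 * q1 + b * (p1 * q2 + q1 * p2) + 2 * c * p2 * q2 = 0 := F.
  have -> : 2 * d * p1 * q1 + e * (p1 * q2 + q1 * p2) + 2 * h * p2 * q2 = 0 := G.
  by move=> r'; do 4 eexists; exact: r'.
(* The two roots coincide, so the polarization at them is a nonzero multiple of the value at the
   root. *)
have key (x y z : C) : 2 * x * p1 * q1 + y * (p1 * q2 + q1 * p2) + 2 * z * p2 * q2 = 0 ->
    x * p1 ^+ 2 + y * p1 * p2 + z * p2 ^+ 2 = 0.
  move=> h'.
  case: qn => qn; apply: (mulfI (mulf_neq0 n2 qn)).
    apply: (lincomb2 p1 (- (y * p1 + 2 * z * p2)) h' D); ring.
  apply: (lincomb2 p2 (2 * x * p1 + y * p2) h' D); ring.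
have [r1 [r2 D']] : exists r1 r2, p1 * r2 - r1 * p2 != 0.
  case: pn => pn; first by exists 0, 1; rewrite mulr1 mul0r subr0.
  by exists 1, 0; rewrite mulr0 mul1r sub0r oppr_eq0.
exists (lin p1 r1 p2 r2 p); split; first by exists p1, r1, p2, r2.
right; have := lin_rep D' r; rewrite !lin_qform (key _ _ _ F) (key _ _ _ G).
by move=> r'; do 4 eexists; exact: r'.
Qed.

Lemma minors_scale (a b c d e h y : C) : d = y * a -> e = y * b -> h = y * c ->
  [/\ a * e = b * d, a * h = c * d & b * h = c * e].
Proof. by move=> -> -> ->; split; ring. Qed.

(** Here y^3 divides p. If u had an x^2 term, the vanishing of the x^6, x^5 y and x^4 y^2
    coefficients would make v a multiple of u. Hence y divides u and v, and what remains is a binary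
    cubic written as a sum of two cubes of linear forms. *)
Lemma rep_common_root_unique p (b c e h : C) (u v : {mpoly C[2]}) :
  rep p (qform 0 b c) (qform 0 e h) -> rep p u v ->
  [set u ^+ 3; v ^+ 3] = [set qform 0 b c ^+ 3; qform 0 e h ^+ 3].
Proof.
move=> r r'; have [a' [b' [c' [d' [e' [h' [eu ev]]]]]]] := rep_qform r'; subst u v.
have [_ _ np pE] := r; rewrite !qform_cube sformD //= in pE.
rewrite {}pE in r r'.
move/rep_sformP: r => [np1 _].
move/rep_sformP: r' => [np2 [E0 E1 E2 [E3 E4 E5 E6]]].
have [y [y3 dE]] : exists y, y ^+ 3 = 1 /\ d' = y * - a'.
  by apply: cube_eq; apply: (lincomb1 1 E0); ring.
have a0 : a' = 0.
  apply/eqP; apply/negPn/negP => a0; apply: np2; apply: (@minors_scale _ _ _ _ _ _ (- y)).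
  - by rewrite dE; ring.
  - have H : b' + y ^+ 2 * e' = 0.
      by apply: (mulfI (mulf_neq0 n3 (expf_neq0 2 a0))); apply: (lincomb1 1 E1); rewrite dE; ring.
    by apply: (lincomb2 y (- e') H y3); ring.
  - have H : b' + y ^+ 2 * e' = 0.
      by apply: (mulfI (mulf_neq0 n3 (expf_neq0 2 a0))); apply: (lincomb1 1 E1); rewrite dE; ring.
    have eE : e' = - y * b' by apply: (lincomb2 y (- e') H y3); ring.
    have H2 : c' + y ^+ 2 * h' = 0.
      apply: (mulfI (mulf_neq0 n3 (expf_neq0 2 a0))).
      by apply: (lincomb2 1 (3 * a' * b' ^+ 2) E2 y3); rewrite dE eE; ring.
    by apply: (lincomb2 y (- h') H2 y3); ring.
have d0 : d' = 0 by rewrite dE a0 oppr0 mulr0.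
move: d0 {dE}; subst a' => d0; subst d'.
have dd : b * h - c * e != 0.
  by apply/eqP => /subr0_eq D; apply: np1; split; rewrite // !mul0r ?mulr0.
have dd' : b' * h' - c' * e' != 0.
  by apply/eqP => /subr0_eq D; apply: np2; split; rewrite // !mul0r ?mulr0.
have [z [x [z3 x3 cases]]] : exists z y, [/\ z ^+ 3 = 1, y ^+ 3 = 1 &
    [/\ b' = z * b, c' = z * c, e' = y * e & h' = y * h] \/
    [/\ b' = z * e, c' = z * h, e' = y * b & h' = y * c]].
  apply: sum_cubes_unique => //.
  - by apply: (lincomb1 1 E3); ring.
  - by apply: (mulfI n3); apply: (lincomb1 1 E4); ring.
  - by apply: (mulfI n3); apply: (lincomb1 1 E5); ring.
have hs (k k1 k2 : C) : k ^+ 3 = 1 -> qform 0 (k * k1) (k * k2) ^+ 3 = qform 0 k1 k2 ^+ 3.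
  by move=> k3; rewrite -[RHS](qform_cube_scale _ _ _ k3) mulr0.
case: cases => -[-> -> -> ->].
  by rewrite !hs.
by rewrite setUC !hs.
Qed.

(** Even quadratic forms are linear forms in x^2 and y^2, so this is again uniqueness for cubics. *)
Lemma rep_even_unique p (a c d h a' c' d' h' : C) :
  rep p (qform a 0 c) (qform d 0 h) -> rep p (qform a' 0 c') (qform d' 0 h') ->
  [set qform a' 0 c' ^+ 3; qform d' 0 h' ^+ 3] = [set qform a 0 c ^+ 3; qform d 0 h ^+ 3].
Proof.
move=> r r'.
have [_ _ np pE] := r; rewrite !qform_cube sformD //= in pE.
rewrite {}pE in r r'.
move/rep_sformP: r => [np1 _].
move/rep_sformP: r' => [np2 [E0 E1 E2 [E3 E4 E5 E6]]].
have dd : a * h - c * d != 0.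
  by apply/eqP => /subr0_eq D; apply: np1; split; rewrite // ?mul0r ?mulr0.
have dd' : a' * h' - c' * d' != 0.
  by apply/eqP => /subr0_eq D; apply: np2; split; rewrite // ?mul0r ?mulr0.
have [z [x [z3 x3 cases]]] : exists z y, [/\ z ^+ 3 = 1, y ^+ 3 = 1 &
    [/\ a' = z * a, c' = z * c, d' = y * d & h' = y * h] \/
    [/\ a' = z * d, c' = z * h, d' = y * a & h' = y * c]].
  apply: sum_cubes_unique => //.
  - by apply: (mulfI n3); apply: (lincomb1 1 E2); ring.
  - by apply: (mulfI n3); apply: (lincomb1 1 E4); ring.
have hs (k k1 k2 : C) : k ^+ 3 = 1 -> qform (k * k1) 0 (k * k2) ^+ 3 = qform k1 0 k2 ^+ 3.
  by move=> k3; rewrite -[RHS](qform_cube_scale _ _ _ k3) mulr0.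
case: cases => -[-> -> -> ->].
  by rewrite !hs.
by rewrite setUC !hs.
Qed.

End Pencils.

(** * The sextics A_t *)

Section Final.
Local Open Scope classical_set_scope.
Variable C : numClosedFieldType.
Implicit Types (p q u v : {mpoly C[2]}) (t : C).

Let n3 : (3 : C) != 0 := nz3 C.
Let n2 : (2 : C) != 0. Proof. by rewrite pnatr_eq0. Qed.

Lemma sextic_AE t : sextic_A t = sform [:: 1; 0; t; 0; t; 0; 1].
Proof. by rewrite sformE /sextic_A -!mul_mpolyC; ring. Qed.

(** For an abstract morphism the identity is within reach of [ring]; [lin_sform] instantiates it at
    a substitution. *)
Lemma rmorph_sform (f : {rmorphism {mpoly C[2]} -> {mpoly C[2]}}) c0 c1 c2 c3 c4 c5 c6 :
  (forall c, f c%:MP = c%:MP) ->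
  f (sform [:: c0; c1; c2; c3; c4; c5; c6]) =
  c0%:MP * f (formX C) ^+ 6 + c1%:MP * (f (formX C) ^+ 5 * f (formY C))
  + c2%:MP * (f (formX C) ^+ 4 * f (formY C) ^+ 2)
  + c3%:MP * (f (formX C) ^+ 3 * f (formY C) ^+ 3)
  + c4%:MP * (f (formX C) ^+ 2 * f (formY C) ^+ 4)
  + c5%:MP * (f (formX C) * f (formY C) ^+ 5) + c6%:MP * f (formY C) ^+ 6.
Proof.
move=> fC; rewrite sformE -[in RHS](fC c0) -[in RHS](fC c1) -[in RHS](fC c2) -[in RHS](fC c3)
  -[in RHS](fC c4) -[in RHS](fC c5) -[in RHS](fC c6).
move: c0%:MP c1%:MP c2%:MP c3%:MP c4%:MP c5%:MP c6%:MP (formX C) (formY C).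
by move=> k0 k1 k2 k3 k4 k5 k6 X Y; ring.
Qed.

Lemma lin_sform a b c d c0 c1 c2 c3 c4 c5 c6
    (x := a%:MP * formX C + b%:MP * formY C) (y := c%:MP * formX C + d%:MP * formY C) :
  lin a b c d (sform [:: c0; c1; c2; c3; c4; c5; c6]) =
  c0%:MP * x ^+ 6 + c1%:MP * (x ^+ 5 * y) + c2%:MP * (x ^+ 4 * y ^+ 2)
  + c3%:MP * (x ^+ 3 * y ^+ 3) + c4%:MP * (x ^+ 2 * y ^+ 4)
  + c5%:MP * (x * y ^+ 5) + c6%:MP * y ^+ 6.
Proof.
rewrite /x /y -(linX a b c d) -(linY a b c d); apply: (rmorph_sform
  (f := comp_mpoly [tuple a *: formX C + b *: formY C; c *: formX C + d *: formY C])).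
by move=> k; exact: comp_mpolyC.
Qed.

(** A_t is even in y, so only the square of the image of y enters, and there i disappears. *)
Lemma lin_sextic_A t (l : C) : lin l l ('i * l) (- ('i * l)) (sextic_A t) =
  sform [:: 0; 4 * (3 - t) * l ^+ 6; 0; 8 * (5 + t) * l ^+ 6; 0; 4 * (3 - t) * l ^+ 6; 0].
Proof.
have i2 : ('i : C)%:MP_[2] ^+ 2 = -1 by rewrite -rmorphXn sqrCi rmorphN rmorph1.
rewrite sextic_AE lin_sform sformE.
move: (formX C) (formY C) => X Y.
have hy : (('i * l)%:MP * X + (- ('i * l))%:MP * Y) ^+ 2 = - (l%:MP ^+ 2 * (X - Y) ^+ 2).
  by apply: (lincomb1 (l%:MP ^+ 2 * (X - Y) ^+ 2) i2); ring.
move: (_ + (- ('i * l))%:MP * Y) hy => y hy.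
have -> : y ^+ 6 = (y ^+ 2) ^+ 3 by ring.
have -> : y ^+ 4 = (y ^+ 2) ^+ 2 by ring.
by rewrite hy; ring.
Qed.

Lemma det_rot (l : C) : l != 0 -> l * - ('i * l) - l * ('i * l) != 0.
Proof.
move=> l0; have -> : l * - ('i * l) - l * ('i * l) = -2 * 'i * l ^+ 2 by ring.
by rewrite !mulf_neq0 ?expf_neq0 ?oppr_eq0 ?neq0Ci.
Qed.

Lemma sextic_A_Ps t : t != 3 -> similar_forms (sextic_A t) (Ps (2 * (5 + t) / (3 - t))).
Proof.
move=> t3; have t3' : 3 - t != 0 by rewrite subr_eq0 eq_sym.
have n4 : (4 : C) != 0 by rewrite pnatr_eq0.
(* The scale that makes the x^5 y and x y^5 coefficients equal to 1. *)
pose l : C := 6.-root (4 * (3 - t))^-1.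
have hl : l ^+ 6 = (4 * (3 - t))^-1 by rewrite rootCK.
have l0 : l != 0 by rewrite rootC_eq0 // invr_eq0 mulf_neq0.
exists l, l, ('i * l), (- ('i * l)); split; first exact: det_rot.
rewrite -[RHS]/(lin l l ('i * l) (- ('i * l)) (sextic_A t)) lin_sextic_A hl divff ?mulf_neq0 //.
have e : 8 * (5 + t) * (4 * (3 - t))^-1 = 2 * (5 + t) / (3 - t) by field.
by rewrite e.
Qed.

Lemma N_is_sextic_A t s n : t != 3 -> 2 * (5 + t) = s * (3 - t) -> N_is (Ps s) n ->
  N_is (sextic_A t) n.
Proof.
move=> t3 e; have t3' : 3 - t != 0 by rewrite subr_eq0 eq_sym.
by have /(N_is_similar n) [_] := sextic_A_Ps t3; rewrite e mulfK.
Qed.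

(** If a is nonzero, the three leading coefficients force g to be a multiple of f. If a = 0, then d
    = 0: either c = 0 and both forms are multiples of xy, or the y^6 and x y^5 coefficients force
    b^3 + e^3 = 0, contradicting s != 0. *)
Lemma not_rep_cube s (f g : {mpoly C[2]}) : s != 0 -> ~ rep (sform [:: 0; 0; 0; s; 0; 0; 0]) f g.
Proof.
move=> s0 r; have [a [b [c [d [e [h [ef eg]]]]]]] := rep_qform r; subst f g.
move/rep_sformP: r => [np [E0 E1 E2 [E3 E4 E5 E6]]].
have [y [y3 dE]] : exists y, y ^+ 3 = 1 /\ d = y * - a.
  by apply: cube_eq; apply: (lincomb1 1 E0); ring.
have [z [z3 hE]] : exists y, y ^+ 3 = 1 /\ h = y * - c.
  by apply: cube_eq; apply: (lincomb1 1 E6); ring.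
have [a0|a0] := eqVneq a 0.
  have d0 : d = 0 by rewrite dE a0; ring.
  have [c0|c0] := eqVneq c 0.
    by apply: np; rewrite hE a0 c0 d0; split; ring.
  have H : b + z ^+ 2 * e = 0.
    by apply: (mulfI (mulf_neq0 n3 (expf_neq0 2 c0))); apply: (lincomb1 1 E5); rewrite hE; ring.
  move/eqP: s0; apply; rewrite -E3 a0 d0.
  have -> : b = - (z ^+ 2 * e) by apply: (lincomb1 1 H); ring.
  by apply: (lincomb1 (- e ^+ 3 * (z ^+ 3 + 1)) z3); ring.
have H : b + y ^+ 2 * e = 0.
  by apply: (mulfI (mulf_neq0 n3 (expf_neq0 2 a0))); apply: (lincomb1 1 E1); rewrite dE; ring.
have eE : e = - y * b by apply: (lincomb2 y (- e) H y3); ring.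
have H2 : c + y ^+ 2 * h = 0.
  apply: (mulfI (mulf_neq0 n3 (expf_neq0 2 a0))).
  by apply: (lincomb2 1 (3 * a * b ^+ 2) E2 y3); rewrite dE eE; ring.
apply: np; apply: (@minors_scale C _ _ _ _ _ _ (- y)); rewrite // ?dE; first by ring.
by apply: (lincomb2 y (- h) H2 y3); ring.
Qed.

Lemma N_is_sextic_A3 : N_is (sextic_A (3 : C)) 0.
Proof.
have D : (1 : C) * - 'i - 1 * 'i != 0.
  by have := det_rot (oner_neq0 C); rewrite !mulr1.
have sim : similar_forms (sextic_A (3 : C)) (lin 1 1 'i (- 'i) (sextic_A 3)).
  by exists 1, 1, 'i, (- 'i).
apply/(N_is_similar 0 sim).
have := lin_sextic_A 3 (1 : C); rewrite !mulr1 subrr mulr0 mul0r => ->.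
apply: (@N_is_seq C _ [::]) => // f g /not_rep_cube; case.
by rewrite expr1n mulr1 mulf_neq0 // -?natrD pnatr_eq0.
Qed.

(** * From exactly two representations to the form A_t *)

Lemma lin_sum_cubes a b c d p q : lin a b c d (p ^+ 3 + q ^+ 3) =
  lin a b c d p ^+ 3 + lin a b c d q ^+ 3.
Proof. by rewrite !linE. Qed.

(** The odd coefficients cancel, leaving 2a^3, 6a(ac + b^2), 6c(ac + b^2), 2c^3. Scaling y relative
    to x by r with r^2 = a/c makes this palindromic, and al normalizes the extreme coefficients to
    1. *)
Lemma similar_sextic_A (a b c : C) : a != 0 -> c != 0 ->
  exists t, similar_forms (qform a b c ^+ 3 + qform a (- b) c ^+ 3) (sextic_A t).
Proof.
move=> a0 c0.
pose al : C := 6.-root (2 * a ^+ 3)^-1; pose r : C := sqrtC (a / c).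
have hal : al ^+ 6 = (2 * a ^+ 3)^-1 by rewrite rootCK.
have al0 : al != 0 by rewrite rootC_eq0 // invr_eq0 mulf_neq0 ?expf_neq0.
have hr : r ^+ 2 = a / c by rewrite sqrtCK.
have r0 : r != 0 by rewrite sqrtC_eq0 mulf_neq0 ?invr_eq0.
clearbody al r.
exists (6 * a * (a * c + b ^+ 2) * al ^+ 6 * (a / c)), al, 0, 0, (al * r); split.
  by rewrite mul0r subr0 !mulf_neq0.
rewrite -[RHS]/(lin al 0 0 (al * r) _) lin_sum_cubes !lin_qform !qform_cube sformD //= sextic_AE.
congr (sform [:: _; _; _; _; _; _; _]); try ring.
- have -> : (a * al ^+ 2 + b * al * 0 + c * 0 ^+ 2) ^+ 3 +
     (a * al ^+ 2 + - b * al * 0 + c * 0 ^+ 2) ^+ 3 = 2 * a ^+ 3 * al ^+ 6 by ring.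
  by rewrite hal divff // mulf_neq0 ?expf_neq0.
- rewrite -hr; ring.
- transitivity (6 * c * (a * c + b ^+ 2) * al ^+ 6 * r ^+ 2 * r ^+ 2); last by ring.
  by rewrite hr; field.
- transitivity (2 * c ^+ 3 * al ^+ 6 * (r ^+ 2) ^+ 3); last by ring.
  by rewrite hr hal; field; rewrite a0 c0.
Qed.

(** For linear forms in x^2 and y^2: a sum of two cubes without its two leading coefficients comes
    from dependent forms. It excludes A = 0 and, mirrored, G = 0 in [N2_even]. *)
Lemma dependent_of_cubes (a c d h : C) :
  a ^+ 3 + d ^+ 3 = 0 -> a ^+ 2 * c + d ^+ 2 * h = 0 -> a * h = c * d.
Proof.
move=> E0 E1.
have [y [y3 dE]] : exists y, y ^+ 3 = 1 /\ d = y * - a.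
  by apply: cube_eq; apply: (lincomb1 1 E0); ring.
have [a0|a0] := eqVneq a 0; first by rewrite dE a0; ring.
have H : c + y ^+ 2 * h = 0.
  by apply: (mulfI (expf_neq0 2 a0)); apply: (lincomb1 1 E1); rewrite dE; ring.
rewrite dE; apply: (lincomb2 (y * a) (- h * a) H y3); ring.
Qed.

(* The reflection y -> -y fixes the representation by even forms, hence the other one as well;
   by uniqueness it cannot fix both cubes, so it exchanges them. *)
Lemma N2_even p (a c d h : C) : N_is p 2 -> rep p (qform a 0 c) (qform d 0 h) ->
  exists t, similar_forms p (sextic_A t).
Proof.
move=> N2 r.
pose sg := lin (1 : C) 0 0 (-1).
have D : (1 : C) * -1 - 0 * 0 != 0 by rewrite mul0r subr0 mul1r oppr_eq0 oner_neq0.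
have sgq (x y z : C) : sg (qform x y z) = qform x (- y) z.
  by rewrite /sg lin_qform; congr qform; ring.
have sgK : involutive sg.
  by move=> q; apply: lin_lin_id; ring.
have sgp : sg p = p.
  by have [_ _ _ ->] := r; rewrite /sg lin_sum_cubes -!/(sg _) !sgq oppr0.
have sgX (q : {mpoly C[2]}) : sg (q ^+ 3) = sg q ^+ 3 by rewrite /sg linE.
pose S1 := [set qform a 0 c ^+ 3; qform d 0 h ^+ 3].
have hS1 : representations p S1 by apply/representationsE; do 2 eexists; split; first exact: r.
have sgS1 : sg @` S1 = S1 by rewrite image_setU !image_set1 !sgX !sgq oppr0.
have [S2 [hS2 S12 all]] : exists S2, [/\ representations p S2, S2 <> S1 &
    forall S, representations p S -> S = S1 \/ S = S2].
  have [T1 [T2 [T12 E]]] := N_is2 N2.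
  move: hS1; rewrite E => -[e|e]; [exists T2|exists T1]; rewrite e; split=> //.
  - by right.
  - by move=> e'; apply: T12.
  - by left.
  - by move=> S [] ->; [right|left].
have /representationsE[u [v [ruv S2E]]] := hS2.
have sgS2 : sg @` S2 = S2.
  have : representations p (sg @` S2).
    rewrite -{1}sgp /sg lin_representations //; by exists S2.
  case/all => // e; case: S12.
  rewrite -sgS1 -e; apply/seteqP; split=> x /=.
    by move=> Sx; exists (sg x) => //; exists x.
  by move=> [_ [y Sy <-] <-]; rewrite sgK.
rewrite S2E image_setU !image_set1 !sgX in sgS2.
have hcases := eq_set2 sgS2.
have fix_even (x y z : C) : sg (qform x y z) ^+ 3 = qform x y z ^+ 3 -> y = 0.
  rewrite sgq => e; have := congr1 (@coefs4 C) e; rewrite !coefs4_cube => -[H1 H3].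
  have [x0|x0] := eqVneq x 0.
    have y3 : y ^+ 3 = 0.
      by apply: (mulfI n2); apply: (lincomb1 (-1) H3); rewrite x0; ring.
    by apply/eqP; move/eqP: y3; rewrite expf_eq0.
  apply: (mulfI (mulf_neq0 n2 (mulf_neq0 n3 (expf_neq0 2 x0)))).
  by apply: (lincomb1 (-1) H1); ring.
have [A [B [G [A' [B' [G' [eu ev]]]]]]] := rep_qform ruv.
have [_ _ npuv puv] := ruv.
case: hcases => [[hu hv]|[hu hv]].
  case: S12; move: hu hv; rewrite S2E eu ev => /fix_even B0 /fix_even B0'.
  rewrite eu ev B0 B0' in ruv; rewrite B0 B0'; exact: rep_even_unique r ruv.
have puv' : p = qform A B G ^+ 3 + qform A (- B) G ^+ 3.
  by rewrite puv -hu eu sgq.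
have [_ _ np pE] := r.
rewrite puv' !qform_cube !sformD // in pE.
move/sform_inj: pE => /(_ erefl erefl)/= [E0 _ E2 _ E4 _ E6].
(* If A = 0, the x^6 and x^4 y^2 coefficients 2A^3 and 6A(AG + B^2) of p vanish. *)
have A0 : A != 0.
  apply/eqP => A0; apply: np; apply/qform_proportional; split; rewrite ?mul0r ?mulr0 //.
  apply: dependent_of_cubes; first by rewrite -E0 A0; ring.
  by apply: (mulfI n3); apply: (lincomb1 (-1) E2); rewrite A0; ring.
have G0 : G != 0.
  apply/eqP => G0; apply: np; apply/qform_proportional; split; rewrite ?mul0r ?mulr0 //.
  apply/esym; apply: dependent_of_cubes; first by rewrite -E6 G0; ring.
  by apply: (mulfI n3); apply: (lincomb1 (-1) E4); rewrite G0; ring.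
by rewrite puv'; apply: similar_sextic_A.
Qed.

Lemma N2_similar p : N_is p 2 -> exists t, similar_forms p (sextic_A t).
Proof.
move=> N2; have [S1 [S2 [S12 E]]] := N_is2 N2.
have /representationsE[f [g [r S1E]]] : representations p S1 by rewrite E; left.
have [q [pq []]] := pencil_normal_form r.
  move=> [a [c [d [h rq]]]].
  have [t qt] := N2_even ((N_is_similar 2 pq).1 N2) rq.
  by exists t; apply: similar_trans qt.
move=> [b [c [e [h rq]]]].
have [T1 [T2 [T12 ET]]] := N_is2 ((N_is_similar 2 pq).1 N2).
have /representationsE[f1 [g1 [r1 T1E]]] : representations q T1 by rewrite ET; left.
have /representationsE[f2 [g2 [r2 T2E]]] : representations q T2 by rewrite ET; right.
case: T12; rewrite T1E T2E.
by rewrite (rep_common_root_unique rq r1) (rep_common_root_unique rq r2).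
Qed.

Lemma N_is_sextic_A_generic t : t \notin [:: 3; -1; 0; 15; -5] -> N_is (sextic_A t) 2.
Proof.
rewrite !inE !negb_or => /and5P[t3 tN1 t0 t15 tN5].
have t3' : 3 - t != 0 by rewrite subr_eq0 eq_sym.
have n4 : (4 : C) != 0 by rewrite pnatr_eq0.
apply: (N_is_sextic_A (s := 2 * (5 + t) / (3 - t)) t3); first by rewrite divfK.
have sE : 2 * (5 + t) / (3 - t) * (3 - t) = 2 * (5 + t) by rewrite divfK.
move: (2 * (5 + t) / (3 - t)) sE => s sE.
have [w hw] := exists_omega C.
(* The excluded s correspond to t = -1, to no t, to t = -5, and to t(t - 15) = 0. *)
apply: (N_Ps_generic hw); apply/eqP => h.
- move/eqP: tN1; apply; apply: (mulfI n4).
  by apply: (lincomb1 (-1) sE); rewrite h; ring.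
- have /eqP : (16 : C) = 0 by apply: (lincomb1 (-1) sE); rewrite h; ring.
  by rewrite pnatr_eq0.
- move/eqP: tN5; apply; apply: (mulfI n2).
  by apply: (lincomb1 (-1) sE); rewrite h; ring.
- have n64 : (64 : C) != 0 by rewrite pnatr_eq0.
  have : 64 * (t * (t - 15)) = 0.
    have e : 9 * (s * (3 - t)) ^+ 2 = 100 * (3 - t) ^+ 2 by rewrite -h; ring.
    by rewrite sE in e; apply: (lincomb1 (-1) e); ring.
  move/eqP; rewrite !mulf_eq0 (negPf n64) (negPf t0) /= subr_eq0.
  by rewrite (negPf t15).
Qed.

Lemma N_is_sextic_A_special :
  [/\ N_is (sextic_A (-1 : C)) 1, N_is (sextic_A (0 : C)) 4,
      N_is (sextic_A (15 : C)) 4 & N_is (sextic_A (-5 : C)) 6].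
Proof.
have [w hw] := exists_omega C.
have sub (m n : nat) : (m != n) -> m%:R != n%:R :> C by rewrite eqr_nat.
have neg (m : nat) : - m%:R != 3 :> C by rewrite eq_sym -addr_eq0 -natrD pnatr_eq0 addSn.
split.
- by apply: (N_is_sextic_A (s := 2)) (N_Ps_2 hw); [exact: neg 1%N|ring].
- apply: (N_is_sextic_A (s := 10 / 3)); [exact: sub 0%N 3%N _|by field|].
  by apply: (N_Ps_hex hw); field.
- apply: (N_is_sextic_A (s := - 10 / 3)); [exact: sub 15%N 3%N _|by field|].
  by apply: (N_Ps_hex hw); field.
- by apply: (N_is_sextic_A (s := 0)) (N_Ps_0 hw); [exact: neg 5%N|ring].
Qed.

End Final.

Theorem theorem5p4 (R : realType) :
  (forall p : {mpoly R[i][2]}, p \is 6.-homog ->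
     (N_is p 2 <->
      exists t : R[i], t \notin [:: 3; -1; 0; 15; -5] /\ similar_forms p (sextic_A t)))
  /\ N_is (sextic_A (3 : R[i])) 0
  /\ N_is (sextic_A (-1 : R[i])) 1
  /\ N_is (sextic_A (0 : R[i])) 4
  /\ N_is (sextic_A (15 : R[i])) 4
  /\ N_is (sextic_A (-5 : R[i])) 6.
Proof.
have [NN1 N0 N15 NN5] := N_is_sextic_A_special R[i].
have N3 := N_is_sextic_A3 R[i].
split; last exact: (conj N3 (conj NN1 (conj N0 (conj N15 NN5)))).
move=> p _; split.
  move=> N2; have [t pt] := N2_similar N2; exists t; split; last exact: pt.
  have Nt := (N_is_similar 2 pt).1 N2.
  rewrite !inE !negb_or.
  (* Similarity preserves the count, and each excluded t has a count other than 2. *)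
  apply/and5P; split; apply/eqP => te; rewrite te in Nt.
  - by have := N_is_inj N3 Nt.
  - by have := N_is_inj NN1 Nt.
  - by have := N_is_inj N0 Nt.
  - by have := N_is_inj N15 Nt.
  - by have := N_is_inj NN5 Nt.
by move=> [t [tn pt]]; apply/(N_is_similar 2 pt); apply: N_is_sextic_A_generic.
Qed.
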